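(* Let $n\ge 1$. For each $i=1,\dots,n$, the formula $$\Omega_i(u\,\partial_x, v\,\partial_x)=\int_{p_i}^{p_{i+1}}\bigl(u_xv_{xx}-u_{xx}v_x\bigr)\,dx,$$ where $u\,\partial_x$ and $v\,\partial_x$ are vector fields on $S^1$ with breaks at the same points $p_1,\dots,p_n$, defines a nontrivial $2$-cocycle on the Lie algebroid $\mathrm{BVect}_n(S^1)$. That is, $\Omega_i$ is a $2$-form on $\mathrm{BVect}_n(S^1)$ satisfying $$L_{\#\mathbf u}\bigl(\Omega_i(\mathbf v,\mathbf w)\bigr)-\Omega_i\bigl([\![\mathbf u,\mathbf v]\!],\mathbf w\bigr)+(\text{cyclic permutations of }\mathbf u,\mathbf v,\mathbf w)=0$$ for all smooth sections $\mathbf u,\mathbf v,\mathbf w$, and $\Omega_i$ is not a coboundary.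
   Context: Base. $S^1=\mathbb R/\mathbb Z$ with coordinate $x$; $B\subset (S^1)^n$ is the manifold of $n$-tuples $p=(p_1,\dots,p_n)$ of distinct cyclically ordered points of $S^1$; $p_{n+1}:=p_1$. $[p_i,p_{i+1}]$ is the positively oriented arc from $p_i$ to $p_{i+1}$ (for $n=1$, the whole circle cut at $p_1$), and integrals over it use the one-sided derivatives at its ends. Broken vector fields. A vector field with breaks at $p_1,\dots,p_n$ is a continuous vector field $u(x)\partial_x$ on $S^1$ which on each arc $[p_i,p_{i+1}]$ is smooth up to the boundary (smooth on $S^1\setminus\{p_1,\dots,p_n\}$, with one-sided derivatives of all orders at each $p_i$). $\mathrm{BVect}_n(S^1)$ is the vector bundle over $B$ whose fiber over $p$ is the space of vector fields with breaks at $p_1,\dots,p_n$. A smooth section is a family $\mathbf u=u(x,p)\partial_x$ with $u$ continuous on $S^1\times B$ and smooth up to the boundary on each connected component of the complement of the hypersurfaces $\{x=p_i\}$ (i.e. smooth on the manifold with boundary obtained by cutting $S^1\times B$ along these hypersurfaces). Lie algebroid structure. The anchor sends $\mathbf u$ to the vector field $\#\mathbf u=\sum_{i=1}^n u(p_i,p)\,\partial_{p_i}$ on $B$. The bracket of sections $\mathbf u=u(x,p)\partial_x$, $\mathbf v=v(x,p)\partial_x$ is $$[\![\mathbf u,\mathbf v]\!]=\bigl(u v_x-v u_x\bigr)\partial_x+\sum_{i=1}^n\bigl(u(p_i,p)\,v_{p_i}(x,p)-v(p_i,p)\,u_{p_i}(x,p)\bigr)\partial_x ,$$ subscripts denoting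 partial derivatives. $L_{X}f$ denotes the derivative of a function $f$ on $B$ along a vector field $X$ on $B$. Forms. A $1$-form (resp. $2$-form) on the algebroid is a fiberwise linear functional (resp. fiberwise skew-symmetric bilinear form) taking smooth sections to smooth functions on $B$. A $2$-form $\Omega$ is a coboundary if there is a $1$-form $\Theta$ with $\Omega(\mathbf u,\mathbf v)=L_{\#\mathbf u}\Theta(\mathbf v)-L_{\#\mathbf v}\Theta(\mathbf u)-\Theta([\![\mathbf u,\mathbf v]\!])$ for all smooth sections $\mathbf u,\mathbf v$; a cocycle is nontrivial if it is not a coboundary. *)

(* Defs.v *)
From HB Require Import structures.
From mathcomp Require Import all_boot all_order all_algebra.
From mathcomp Require Import all_classical all_reals all_analysis.
Import Order.TTheory GRing.Theory Num.Theory.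
Import numFieldNormedType.Exports.

Set Implicit Arguments.
Unset Strict Implicit.
Unset Printing Implicit Defensive.

Local Open Scope classical_set_scope.
Local Open Scope ring_scope.

Section SmoothOn.
Context {R : realType} {V : normedModType R}.
Implicit Types (W : set V) (f : V -> R) (v z : V).

Definition diff_quot f v z (h : R) : R := h^-1 * (f (z + h *: v) - f z).

(* The derivative of f at z along v, using only points of W.  It is the usual
   directional derivative at an interior point of W; at a boundary point it is
   one-sided when v is transversal to the boundary. *)
Definition within_step W v z : set_system R :=
  within [set h | W (z + h *: v)] 0^'.

Definition derivable_on W f v z := cvg (diff_quot f v z h @[h --> within_step W v z]).

Definition derive_on W v f : V -> R :=
  fun z => lim (diff_quot f v z h @[h --> within_step W v z]).

Fixpoint iter_derive_on W (vs : seq V) f : V -> R :=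
  if vs is v :: vs' then derive_on W v (iter_derive_on W vs' f) else f.

(* C^oo on W.  It is only used when W is open, a compact interval of R, or one
   of the sets [cut_component i] below, which locally are half-spaces; in the
   last two cases it is smoothness up to the boundary: the derivatives of all
   orders, one-sided at the boundary, exist and are continuous on W. *)
Definition smooth_on W f := forall vs : seq V,
  {within W, continuous (iter_derive_on W vs f)} /\
  forall v z, W z -> derivable_on W (iter_derive_on W vs f) v z.

Definition right_derive v f : V -> R :=
  fun z => lim (diff_quot f v z h @[h --> 0^'+]).

Definition left_derive v f : V -> R :=
  fun z => lim (diff_quot f v z h @[h --> 0^'-]).

End SmoothOn.

Section Base.
Variable (R : realType) (n : nat).

(* The group R / Z: [Num.int_num_subdef] is the predicate behind [Num.int],
   the one that carries the additive subgroup structure. *)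
Definition circle :=
  {ideal_quot GRing.ZmodClosed.clone R Num.int_num_subdef _}.

Definition to_circle (x : R) : circle := (\pi_circle x)%qT.

Lemma to_circleP x y : to_circle x = to_circle y <-> x - y \is a Num.int.
Proof.
by rewrite /to_circle; split => [/eqP|xy]; [|apply/eqP];
  rewrite -Quotient.idealrBE.
Qed.

Definition conf := 'I_n -> circle.

Definition to_conf (q : 'rV[R]_n) : conf := fun i => to_circle (q 0 i).

(* The real endpoint of the lifted i-th arc: q_(i+1), and q_1 + 1 for the last
   index. *)
Definition arc_end (q : 'rV[R]_n) (i : 'I_n) : R :=
  q 0 (ordS i) + (i.+1 == n)%:R.

(* q_1 < q_2 < ... < q_n < q_1 + 1 *)
Definition lift_domain : set 'rV[R]_n :=
  [set q : 'rV[R]_n | forall i, q 0 i < arc_end q i].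

(* The n-tuples of distinct cyclically ordered points.  The map [to_conf]
   makes [lift_domain] an infinite cyclic covering of B (two lifts of a point
   differ by an integer multiple of (1,...,1)), so that smoothness and
   derivatives on B are expressed on lifts. *)
Definition B : set conf := to_conf @` lift_domain.

Definition lift (p : conf) : 'rV[R]_n :=
  xget 0 [set q | lift_domain q /\ to_conf q = p].

Definition smooth_fun (f : conf -> R) := smooth_on lift_domain (f \o to_conf).

(* A vector field on B, in the coordinates p_1, ..., p_n. *)
Definition vfield := conf -> 'rV[R]_n.

Definition Lie_derive (X : vfield) (f : conf -> R) : conf -> R :=
  fun p => 'D_(X p) (f \o to_conf) (lift p).

End Base.

Section BrokenFields.
Variable (R : realType) (n : nat).
Local Notation circle := (circle R).
Local Notation conf := (conf R n).
Implicit Types (p : conf) (i j : 'I_n).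

Definition lifted_arc p i : set R := `[lift p 0 i, arc_end (lift p) i].

(* The fiber of BVect_n over p; u stands for u(x) d/dx. *)
Definition BVect p (u : circle -> R) :=
  continuous (u \o @to_circle R) /\
  forall i, smooth_on (V := R^o) (lifted_arc p i) (u \o @to_circle R).

Definition family := circle -> conf -> R.

Definition pullback (u : family) : R^o * 'rV[R]_n -> R :=
  fun z => u (to_circle z.1) (to_conf z.2).

(* The covering of the i-th component of S^1 x B cut along the hypersurfaces
   {x = p_j}. *)
Definition cut_component i : set (R^o * 'rV[R]_n) :=
  [set z | lift_domain z.2 /\ z.2 0 i <= z.1 <= arc_end z.2 i].

Definition smooth_section (u : family) :=
  {within [set z : R^o * 'rV[R]_n | lift_domain z.2],
     continuous (pullback u)} /\
  forall i, smooth_on (cut_component i) (pullback u).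

Definition anchor (u : family) : vfield R n := fun p => \row_i u (p i) p.

(* Off the hypersurfaces {x = p_j} the one-sided derivatives below are the
   ordinary partial derivatives.  At x = p_j, increasing x and decreasing p_j
   both stay in the component of the arc that starts at p_j, so all the terms
   are the boundary values from that component; the sum itself is continuous
   across the hypersurface, the derivative along d/dx + d/dp_j being
   tangent to it. *)
Definition dx (u : family) (x : circle) p : R :=
  right_derive ((1, 0) : R^o * 'rV[R]_n) (pullback u) (repr x, lift p).

Definition dp j (u : family) (x : circle) p : R :=
  left_derive ((0, delta_mx 0 j) : R^o * 'rV[R]_n) (pullback u) (repr x, lift p).

Definition bracket (u v : family) : family := fun x p =>
  (u x p * dx v x p - v x p * dx u x p) +
  \sum_(j < n) (u (p j) p * dp j v x p - v (p j) p * dp j u x p).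

Definition form1 := conf -> (circle -> R) -> R.
Definition form2 := conf -> (circle -> R) -> (circle -> R) -> R.

Definition is_form1 (Theta : form1) :=
  (forall p, B p -> forall (c : R) u v, BVect p u -> BVect p v ->
     Theta p (fun x => c * u x + v x) = c * Theta p u + Theta p v) /\
  (forall u, smooth_section u -> smooth_fun (fun p => Theta p (u^~ p))).

Definition is_form2 (Om : form2) :=
  [/\ forall p, B p -> forall (c : R) u v w,
        BVect p u -> BVect p v -> BVect p w ->
        Om p (fun x => c * u x + v x) w = c * Om p u w + Om p v w,
      forall p, B p -> forall (c : R) u v w,
        BVect p u -> BVect p v -> BVect p w ->
        Om p u (fun x => c * v x + w x) = c * Om p u v + Om p u w,
      forall p, B p -> forall u v, BVect p u -> BVect p v ->
        Om p u v = - Om p v u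
    & forall u v, smooth_section u -> smooth_section v ->
        smooth_fun (fun p => Om p (u^~ p) (v^~ p))].

Definition cocycle_term (Om : form2) (u v w : family) p : R :=
  Lie_derive (anchor u) (fun p' => Om p' (v^~ p') (w^~ p')) p -
  Om p ((bracket u v)^~ p) (w^~ p).

Definition is_cocycle (Om : form2) :=
  forall u v w, smooth_section u -> smooth_section v -> smooth_section w ->
  forall p, B p ->
  cocycle_term Om u v w p + cocycle_term Om v w u p + cocycle_term Om w u v p
  = 0.

Definition is_coboundary (Om : form2) :=
  exists2 Theta : form1, is_form1 Theta &
  forall u v, smooth_section u -> smooth_section v -> forall p, B p ->
  Om p (u^~ p) (v^~ p) =
    Lie_derive (anchor u) (fun p' => Theta p' (v^~ p')) p -
    Lie_derive (anchor v) (fun p' => Theta p' (u^~ p')) p -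
    Theta p ((bracket u v)^~ p).

Definition Omega i : form2 := fun p u v =>
  let D := derive_on (V := R^o) (lifted_arc p i) 1 in
  let U := u \o @to_circle R in
  let V := v \o @to_circle R in
  Rintegral lebesgue_measure (lifted_arc p i)
    (fun x => D U x * D (D V) x - D (D U) x * D V x).

End BrokenFields.

(* Main.v *)
Require Import Defs.
From HB Require Import structures.
From mathcomp Require Import all_boot all_order all_algebra.
From mathcomp Require Import all_classical all_reals all_analysis.
From mathcomp Require Import ring lra.
Import Order.TTheory GRing.Theory Num.Theory.
Import numFieldNormedType.Exports.
Set Implicit Arguments.
Unset Strict Implicit.
Unset Printing Implicit Defensive.
Local Open Scope classical_set_scope.
Local Open Scope ring_scope.

(** The form [Omega i] is closed for a local reason and not exact for an
    algebraic one.

    On the i-th component of the space cut along the hypersurfaces [x = p_j],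
    a section [u] acts on functions as the vector field [u d/dx + X], where [X]
    is its anchor; if [Y] is the anchor of [v], the bracket of [u] and [v] is
    [(u d/dx + X) v - (v d/dx + Y) u] ([bracket_cell]).  The end points of the
    arc move with the velocities [u(p_i)] and [u(p_(i+1))], so the Lie derivative
    of the integral of [f] over the arc along the anchor is the integral of
    [u_x f + (u d/dx + X) f] ([has_deriv_arc_integral]).  The cyclic sum is therefore the integral of an
    expression in the derivatives of the three sections, and this expression
    vanishes identically at interior points because the mixed derivatives
    commute ([cocycle_density_sum]).  End points of the arc are negligible for
    the integral, hence the values of one-sided derivatives there never matter.

    The analysis rests on a calculus of directional derivatives relative to a
    set [W] possibly with boundary: sums, products, affine substitutions,
    the mean value theorem, linearity in the direction and symmetry of second
    derivatives at interior points.  That smooth functions are stable under sums,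
    products and affine substitutions follows by coinduction ([smooth_coind]),
    and so does the smoothness of an integral over the moving arc, once the
    arc is rescaled to the unit interval ([par_integral_smooth]).

    For nontriviality, let [y] be the distance to the beginning of the arc, [l]
    the length of the arc, [r = l - y], and let [u_a] be [y^a r d/dx] on the
    i-th arc and zero elsewhere.  These fields vanish at the breaks, so their
    anchors are zero and a coboundary takes the value [- Theta([u, v])] on them.
    Now [[u_1, u_4] = 3 y^4 r^2 d/dx = 3 [u_2, u_3]], whereas
    [Omega i (u_1, u_4) = l^5] and [Omega i (u_2, u_3) = 2/5 l^5]. *)

(* [lift] and [family] also name notions on ordinals and finite functions. *)
Local Notation lift := Defs.lift.
Local Notation family := Defs.family.

(** * Directional derivatives relative to a set *)

Lemma cvg_within_comp {S T : topologicalType} (W1 : set S) (W2 : set T) (A : S -> T) z :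
  {for z, continuous A} -> (forall y, W1 y -> W2 (A y)) ->
  A y @[y --> within W1 (nbhs z)] --> within W2 (nbhs (A z)).
Proof.
move=> cA W12 P WP.
have nP : \forall y \near within W1 (nbhs z), W2 (A y) -> P (A y).
  exact: (@cvg_within S (nbhs z) _ W1 _ (cA _ WP)).
change (\forall y \near within W1 (nbhs z), P (A y)).
near=> y; have Wy : W1 y by near: y; exact: near_withinT.
by apply: (near nP y) => //; exact: W12.
Unshelve. all: by end_near. Qed.

Lemma near0_lt (R : realType) (d : R) : 0 < d -> \forall h \near (0 : R)^', `|h| < d.
Proof.
move=> d0; have nd : \forall h \near (0 : R), h \in `]- d, d[.
  by apply: near_in_itvoo; rewrite in_itv /=; lra.
by apply: cvg_within; apply: (@filterS R (nbhs (0 : R)) _ _ _ _ nd) => h; rewrite in_itv /= ltr_norml.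
Qed.

Section Directional.
Context {R : realType} {V : normedModType R}.
Implicit Types (W : set V) (f g : V -> R) (v w z : V) (l : R).

#[global] Instance within_step_filter W v z : Filter (within_step W v z).
Proof. exact: within_filter. Qed.

(** Every direction can be probed at every point of [W]: the derivatives
    relative to [W] are then unique limits. *)
Definition fat W := forall z v, W z -> ProperFilter (within_step W v z).

(** [l] is the derivative of [f] at [z] along [v], through points of [W]. *)
Definition has_deriv W v f z l :=
  diff_quot f v z h @[h --> within_step W v z] --> l.

Lemma derive_onE W v f z l : fat W -> W z -> has_deriv W v f z l ->
  derive_on W v f z = l.
Proof. by move=> fW Wz; have ? := fW z v Wz => /cvg_lim; apply. Qed.

Lemma has_derive_on W v f z : derivable_on W f v z ->
  has_deriv W v f z (derive_on W v f z).
Proof. by []. Qed.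

Lemma has_deriv_derivable W v f z l : has_deriv W v f z l -> derivable_on W f v z.
Proof. by move=> h; apply/cvg_ex; exists l. Qed.

Lemma within_step_neq0 W v z : \forall h \near within_step W v z, h != 0.
Proof.
have h0 : within_step W v z `=>` (0 : R)^' by exact: cvg_within.
apply: (h0 (fun h => h != 0)); rewrite /dnbhs /within /=; exact: nearW.
Qed.

Lemma within_step_in W v z : \forall h \near within_step W v z, W (z + h *: v).
Proof. exact: near_withinT. Qed.

Lemma within_step_cvg0 W v z : within_step W v z `=>` nbhs (0 : R).
Proof. by move=> P P0; exact: (@cvg_within _ _ _ _ P (@cvg_within _ _ _ _ P P0)). Qed.

Lemma step_cvg v z : z + h *: v @[h --> (0 : R)] --> z.
Proof.
rewrite -[X in _ --> X]addr0 -[X in _ --> _ + X](scale0r v).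
by apply: cvgD; [exact: cvg_cst|apply: cvgZr_tmp; exact: cvg_id].
Qed.

Lemma within_step_nbhs W v z : nbhs z W -> within_step W v z = (0 : R)^'.
Proof.
move=> Wz; apply/seteqP; split => P; last by exact: cvg_within.
rewrite /within_step /within /= => PW.
have : \forall h \near (0 : R)^', W (z + h *: v).
  by apply: nbhs_dnbhs; exact: (step_cvg v Wz).
by apply: filterS2 PW => h; apply.
Qed.

Lemma has_deriv_nbhs W v f z l : nbhs z W ->
  has_deriv W v f z l = (diff_quot f v z h @[h --> 0^'] --> l).
Proof. by move=> Wz; rewrite /has_deriv within_step_nbhs. Qed.

Lemma fat_open W : open W -> fat W.
Proof.
move=> oW z v Wz; rewrite within_step_nbhs; first exact: Proper_dnbhs_numFieldType.
exact: open_nbhs_nbhs.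
Qed.

(** The derivative at [z] only depends on the values on [W] near [z]. *)
Lemma eq_has_deriv W (O : set V) v f g z l : open O -> O z -> W z ->
  (forall y, W y -> O y -> f y = g y) -> has_deriv W v f z l -> has_deriv W v g z l.
Proof.
move=> oO Oz Wz fg; apply: cvg_trans; apply: near_eq_cvg.
have : \forall h \near within_step W v z, O (z + h *: v).
  by apply: within_step_cvg0; apply: (step_cvg v (open_nbhs_nbhs _)).
apply: filterS2 (within_step_in W v z) => h Wh Oh.
by rewrite /diff_quot !fg.
Qed.

Lemma eq_derive_on W (O : set V) v f g z : open O -> O z -> W z ->
  (forall y, W y -> O y -> f y = g y) -> derive_on W v f z = derive_on W v g z.
Proof.
move=> oO Oz Wz fg; rewrite /derive_on; congr lim.
have near_eq : \forall h \near within_step W v z, diff_quot f v z h = diff_quot g v z h.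
  have : \forall h \near within_step W v z, O (z + h *: v).
    by apply: within_step_cvg0; apply: (step_cvg v (open_nbhs_nbhs _)).
  apply: filterS2 (within_step_in W v z) => h Wh Oh.
  by rewrite /diff_quot !fg.
apply/seteqP; split; apply: near_eq_cvg => //.
by apply: filterS near_eq => h ->.
Qed.

Lemma has_deriv_cst W v (c : R) z : has_deriv W v (cst c) z 0.
Proof.
rewrite /has_deriv (_ : diff_quot _ _ _ = cst 0); first exact: cvg_cst.
by apply/funext => h; rewrite /diff_quot /= subrr mulr0.
Qed.

Lemma has_derivD W v f g z lf lg : has_deriv W v f z lf -> has_deriv W v g z lg ->
  has_deriv W v (fun y => f y + g y) z (lf + lg).
Proof.
move=> hf hg; rewrite /has_deriv.
rewrite (_ : diff_quot _ _ _ = (diff_quot f v z \+ diff_quot g v z)).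
  exact: cvgD.
by apply/funext => h; rewrite /diff_quot /=; ring.
Qed.

Lemma has_deriv_cvg W v f z l : has_deriv W v f z l ->
  f (z + h *: v) @[h --> within_step W v z] --> f z.
Proof.
move=> hf; rewrite -[X in _ --> X]add0r -[X in _ --> X + _](mul0r l).
have : (h * diff_quot f v z h + f z) @[h --> within_step W v z] --> 0 * l + f z.
  apply: cvgD; last exact: cvg_cst.
  by apply: cvgM => //; exact: within_step_cvg0.
apply: cvg_trans; apply: near_eq_cvg.
near=> h.
have h0 : h != 0 by near: h; exact: within_step_neq0.
by rewrite /diff_quot mulrA mulfV// mul1r subrK.
Unshelve. all: by end_near. Qed.

Lemma has_derivM W v f g z lf lg : has_deriv W v f z lf -> has_deriv W v g z lg ->
  has_deriv W v (fun y => f y * g y) z (lf * g z + f z * lg).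
Proof.
move=> hf hg; rewrite /has_deriv.
rewrite (_ : diff_quot _ _ _ =
   (fun h => diff_quot f v z h * g (z + h *: v) + f z * diff_quot g v z h)).
  apply: cvgD; apply: cvgM => //; [exact: has_deriv_cvg hg|exact: cvg_cst].
by apply/funext => h; rewrite /diff_quot /=; ring.
Qed.

(** For [c = 0] both sides vanish; otherwise the step is rescaled by [c]. *)
Lemma has_derivZ W v f z l (c : R) : has_deriv W v f z l ->
  has_deriv W (c *: v) f z (c * l).
Proof.
have [->|c0] := eqVneq c 0.
  move=> _; rewrite mul0r scale0r /has_deriv (_ : diff_quot _ _ _ = cst 0).
    exact: cvg_cst.
  by apply/funext => h; rewrite /diff_quot /= scaler0 addr0 subrr mulr0.
move=> hf.
have hc : c * h @[h --> within_step W (c *: v) z] --> within_step W v z.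
  move=> P; rewrite /within_step /within /= => /= P0.
  rewrite nbhs_simpl /=.
  have c00 : (c * h) @[h --> (0 : R)] --> (0 : R).
    by rewrite -[X in _ --> X](mulr0 c); apply: cvgM; [exact: cvg_cst|exact: cvg_id].
  move: (c00 _ P0); rewrite /= => P0c.
  apply: (@filterS R (nbhs (0 : R)) _ _ _ _ P0c) => h /= Ph h0 Wh.
  apply: Ph; first by rewrite mulf_neq0.
  by move: Wh; rewrite scalerA mulrC.
have : c * diff_quot f v z (c * h) @[h --> within_step W (c *: v) z] --> c * l.
  by apply: cvgM; [exact: cvg_cst|exact: (cvg_comp _ _ hc hf)].
apply: cvg_trans; apply: near_eq_cvg.
near=> h.
have h0 : h != 0 by near: h; exact: within_step_neq0.
by rewrite /diff_quot scalerA [h * c]mulrC invfM !mulrA mulfV// mul1r.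
Unshelve. all: by end_near. Qed.

Lemma smooth_continuous W f : smooth_on W f -> {within W, continuous f}.
Proof. by move=> /(_ [::])[]. Qed.

Lemma smooth_cvg W f z : smooth_on W f -> W z -> f y @[y --> within W (nbhs z)] --> f z.
Proof. by move=> /smooth_continuous/subspace_continuousP; apply. Qed.

Lemma smooth_has_deriv W f v z : smooth_on W f -> W z ->
  has_deriv W v f z (derive_on W v f z).
Proof. by move=> /(_ [::])[_ df] Wz; exact: df. Qed.

Lemma iter_derive_on_cat W us vs f :
  iter_derive_on W (us ++ vs) f = iter_derive_on W us (iter_derive_on W vs f).
Proof. by elim: us => //= u us ->. Qed.

Lemma smooth_derive_on W f v : smooth_on W f -> smooth_on W (derive_on W v f).
Proof.
move=> sf vs; have := sf (vs ++ [:: v]).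
by rewrite iter_derive_on_cat.
Qed.

Lemma eq_iter_derive_on W f g vs : {in W, f =1 g} ->
  {in W, iter_derive_on W vs f =1 iter_derive_on W vs g}.
Proof.
move=> fg; elim: vs => //= v vs IH z /set_mem Wz.
apply: (@eq_derive_on _ setT) => // [|y Wy _]; first exact: openT.
by apply: IH; rewrite inE.
Qed.

Lemma eq_within_continuous W f g : {in W, f =1 g} ->
  {within W, continuous f} -> {within W, continuous g}.
Proof.
move=> fg /subspace_continuousP cf; apply/subspace_continuousP => z Wz.
rewrite /from_subspace -(fg z); last by rewrite inE.
apply: cvg_trans (cf z Wz); apply: near_eq_cvg; near=> y.
apply: fg; rewrite inE; near: y; exact: near_withinT.
Unshelve. all: by end_near. Qed.

(** Smoothness is proved by coinduction: a class of functions that are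
    continuous and differentiable in all directions, and whose derivatives
    agree on [W] with members of the class, consists of smooth functions. *)
Lemma smooth_coind W (C : (V -> R) -> Prop) :
  (forall f, C f -> {within W, continuous f}) ->
  (forall f v, C f -> exists2 g, C g & forall z, W z -> has_deriv W v f z (g z)) ->
  fat W -> forall f, C f -> smooth_on W f.
Proof.
move=> contC dC fW.
have stepC vs f : C f -> exists2 g, C g & {in W, iter_derive_on W vs f =1 g}.
  elim: vs => [|v vs IH] Cf /=; first by exists f.
  have [g Cg fg] := IH Cf; have [g' Cg' gg'] := dC g v Cg.
  exists g' => // z /[dup] zW /set_mem Wz.
  rewrite (@eq_derive_on W setT v _ g)// => [| |y Wy _].
  - by apply: derive_onE => //; exact: gg'.
  - exact: openT.
  - by apply: fg; rewrite inE.
move=> f Cf vs; have [g Cg fg] := stepC vs f Cf; split.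
  apply: (@eq_within_continuous W g); last exact: contC.
  by move=> z zW; rewrite fg.
move=> v z Wz; have [g' Cg' gg'] := dC g v Cg.
apply: (@has_deriv_derivable _ _ _ _ (g' z)).
apply: (@eq_has_deriv W setT v g) => // [|y Wy _|]; first exact: openT.
  by rewrite fg// inE.
exact: gg'.
Qed.

Lemma eq_smooth_on W f g : {in W, f =1 g} -> smooth_on W f -> smooth_on W g.
Proof.
move=> fg sf vs; have [cf df] := sf vs; split.
  exact: eq_within_continuous (eq_iter_derive_on vs fg) cf.
move=> v z Wz; apply: has_deriv_derivable.
apply: (@eq_has_deriv W setT v (iter_derive_on W vs f)) => // [|y Wy _|].
- exact: openT.
- by apply: eq_iter_derive_on => //; rewrite inE.
- exact: (has_derive_on (df v z Wz)).
Qed.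

(** The algebra generated by the smooth functions is stable under
    differentiation, so coinduction gives the smoothness of sums and products
    at once. *)
Inductive generated_algebra W : (V -> R) -> Prop :=
| gen_base f : smooth_on W f -> generated_algebra W f
| gen_add f g : generated_algebra W f -> generated_algebra W g -> generated_algebra W (fun z => f z + g z)
| gen_mul f g : generated_algebra W f -> generated_algebra W g -> generated_algebra W (fun z => f z * g z).

Lemma generated_algebra_smooth W : fat W -> forall f, generated_algebra W f -> smooth_on W f.
Proof.
move=> fW; apply: smooth_coind => //.
- move=> f; elim => {f} [f /smooth_continuous//|f g _ cf _ cg|f g _ cf _ cg].
  + by move=> z; apply: cvgD; [exact: cf|exact: cg].
  + by move=> z; apply: cvgM; [exact: cf|exact: cg].
- move=> f v; elim => {f} [f sf|f g _ [f' cf df] _ [g' cg dg]|f g af [f' cf df] ag [g' cg dg]].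
  + exists (derive_on W v f); first by constructor; exact: smooth_derive_on.
    by move=> z Wz; exact: smooth_has_deriv.
  + exists (fun z => f' z + g' z); first exact: gen_add.
    by move=> z Wz; apply: has_derivD; [exact: df|exact: dg].
  + exists (fun z => f' z * g z + f z * g' z).
      by apply: gen_add; exact: gen_mul.
    by move=> z Wz; apply: has_derivM; [exact: df|exact: dg].
Qed.

Lemma smoothD W f g : fat W -> smooth_on W f -> smooth_on W g ->
  smooth_on W (fun z => f z + g z).
Proof. by move=> fW sf sg; apply: generated_algebra_smooth => //; apply: gen_add; exact: gen_base. Qed.

Lemma smoothM W f g : fat W -> smooth_on W f -> smooth_on W g ->
  smooth_on W (fun z => f z * g z).
Proof. by move=> fW sf sg; apply: generated_algebra_smooth => //; apply: gen_mul; exact: gen_base. Qed.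

Lemma smooth_cst W (c : R) : fat W -> smooth_on W (cst c).
Proof.
move=> fW; apply: (@smooth_coind W (fun f => exists c, f = cst c)) => //; last by exists c.
- by move=> _ [{}c ->] z; exact: cvg_cst.
- move=> _ v [{}c ->]; exists (cst 0); first by exists 0.
  by move=> z _; exact: has_deriv_cst.
Qed.

Lemma smooth_linear W (L : V -> R) : fat W -> continuous L ->
  (forall c y z, L (c *: y + z) = c * L y + L z) -> smooth_on W L.
Proof.
move=> fW cL linL.
apply: (@smooth_coind W (fun f => f = L \/ exists c, f = cst c)) => //; last by left.
- move=> _ [->|[c ->]]; first exact: continuous_subspaceT.
  by move=> z; exact: cvg_cst.
- move=> _ v [->|[c ->]]; last first.
    exists (cst 0); first by right; exists 0.
    by move=> z _; exact: has_deriv_cst.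
  exists (cst (L v)); first by right; exists (L v).
  move=> z Wz; rewrite /has_deriv /=.
  apply: (@cvg_trans _ (cst (L v) @ within_step W v z)); last exact: cvg_cst.
  apply: near_eq_cvg; near=> h.
  have h0 : h != 0 by near: h; exact: within_step_neq0.
  by rewrite /diff_quot [z + _]addrC linL addrK mulKf.
Unshelve. all: by end_near. Qed.

End Directional.

(** Pulling back along an affine map [A] with linear part [A0] that sends [W1]
    into [W2]. *)
Section AffinePullback.
Context {R : realType} {V1 V2 : normedModType R}.
Variables (W1 : set V1) (W2 : set V2) (A A0 : V1 -> V2).
Hypothesis affA : forall z h v, A (z + h *: v) = A z + h *: A0 v.
Hypothesis W12 : forall z, W1 z -> W2 (A z).

Lemma has_deriv_affine v (f : V2 -> R) z l :
  has_deriv W2 (A0 v) f (A z) l -> has_deriv W1 v (f \o A) z l.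
Proof.
move=> hf; rewrite /has_deriv.
rewrite (_ : diff_quot (f \o A) v z = diff_quot f (A0 v) (A z)); last first.
  by apply/funext => h; rewrite /diff_quot /= affA.
apply: cvg_trans hf; apply: cvg_app => P.
move=> PW; apply: (@filterS R 0^' _ _ _ _ PW) => h /= Ph Wh.
by apply: Ph; rewrite -affA; exact: W12.
Qed.

Hypothesis fatW1 : fat W1.
Hypothesis contA : continuous A.

Lemma derive_on_affine v (f : V2 -> R) z : smooth_on W2 f -> W1 z ->
  derive_on W1 v (f \o A) z = derive_on W2 (A0 v) f (A z).
Proof.
move=> sf Wz; apply: derive_onE => //; apply: has_deriv_affine.
exact: smooth_has_deriv (W12 Wz).
Qed.

Lemma smooth_affine (f : V2 -> R) : smooth_on W2 f -> smooth_on W1 (f \o A).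
Proof.
move=> sf.
apply: (@smooth_coind _ _ W1 (fun g => exists2 f, smooth_on W2 f & g = f \o A)) => //;
  last by exists f.
- move=> _ [{sf}f sf ->]; apply/subspace_continuousP => z Wz.
  have AW := @cvg_within_comp _ _ W1 W2 A z (@contA z) W12.
  exact: (cvg_comp _ _ AW (smooth_cvg sf (W12 Wz))).
- move=> _ v [{sf}f sf ->]; exists (derive_on W2 (A0 v) f \o A).
    by exists (derive_on W2 (A0 v) f) => //; exact: smooth_derive_on.
  by move=> z Wz; apply: has_deriv_affine; exact: smooth_has_deriv (W12 Wz).
Qed.

End AffinePullback.

Section MeanValue.
Context {R : realType} {V : normedModType R}.
Implicit Types (W : set V) (f g : V -> R) (v w z : V) (l : R).

(** The mean value theorem on a segment contained in [W]. *)
Lemma segment_MVT W w f z : smooth_on W f ->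
  (forall s : R, 0 <= s <= 1 -> W (z + s *: w)) ->
  exists2 s : R, 0 < s < 1 & f (z + w) - f z = derive_on W w f (z + s *: w).
Proof.
move=> sf Wseg; pose phi (s : R) := f (z + s *: w).
have Wnear (s : R) : 0 < s < 1 -> \forall h \near (0 : R), W (z + s *: w + h *: w).
  move=> /andP[s0 s1].
  have ns : \forall h \near (0 : R), h \in `]- s, 1 - s[.
    by apply: near_in_itvoo; rewrite in_itv /=; lra.
  apply: (@filterS R (nbhs (0 : R)) _ _ _ _ ns) => h; rewrite in_itv /= => /andP[h0 h1].
  rewrite -addrA -scalerDl; apply: Wseg; lra.
have dphi (s : R) : s \in `]0, 1[ -> is_derive s 1 phi (derive_on W w f (z + s *: w)).
  rewrite in_itv /= => /[dup] s01 /andP[s0 s1].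
  have Ws : W (z + s *: w) by apply: Wseg; rewrite !ltW.
  have dq : (fun h : R => h^-1 *: ((phi \o shift s) (h *: 1) - phi s)) =
      diff_quot f w (z + s *: w).
    apply/funext => h; rewrite /diff_quot /phi /= [h *: 1]mulr1.
    by rewrite [_ + s]addrC scalerDl addrA.
  have cv : diff_quot f w (z + s *: w) h @[h --> 0^'] --> derive_on W w f (z + s *: w).
    have E : within_step W w (z + s *: w) = (0 : R)^'.
      apply/seteqP; split; last by move=> P; exact: cvg_within.
      move=> P; rewrite /within_step /within /= => PW.
      near=> h; apply: (near PW h) => //.
      near: h; apply: cvg_within; exact: Wnear.
    by have := smooth_has_deriv (v := w) sf Ws; rewrite /has_deriv E.
  split; first by rewrite /derivable dq; apply/cvg_ex; exists (derive_on W w f (z + s *: w)).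
  by rewrite /derive dq; exact: cvg_lim.
have cphi : {within `[0, 1], continuous phi}.
  have sphi : {within [set s : R | 0 <= s <= 1], continuous phi}.
    apply/subspace_continuousP => s s01.
    have cA : continuous (fun t : R => z + t *: w).
      move=> t; apply: cvgD; first exact: cvg_cst.
      by apply: cvgZr_tmp; exact: cvg_id.
    have AW := @cvg_within_comp _ _ _ W _ s (@cA s) Wseg.
    exact: (cvg_comp _ _ AW (smooth_cvg sf (Wseg _ s01))).
  by rewrite (_ : [set` _] = [set s : R | 0 <= s <= 1])//; apply/seteqP; split => s /=; rewrite in_itv.
have [s s01 E] := MVT ltr01 dphi cphi.
exists s; first by move: s01; rewrite in_itv.
by move: E; rewrite subr0 mulr1 /phi scale1r scale0r addr0.
Unshelve. all: by end_near. Qed.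

Lemma derive_onZ W f v z (c : R) : fat W -> smooth_on W f -> W z ->
  derive_on W (c *: v) f z = c * derive_on W v f z.
Proof.
by move=> fW sf Wz; apply: derive_onE => //; apply: has_derivZ; exact: smooth_has_deriv.
Qed.

Lemma nbhs_ballW W z : nbhs z W -> exists2 e : R, 0 < e & forall y, `|y - z| < e -> W y.
Proof.
move=> /nbhs_ballP[e e0 We]; exists e => // y yz; apply: We.
by rewrite -ball_normE /= distrC.
Qed.

(** Additivity in the direction, by continuity of the directional derivatives. *)
Lemma derive_onD W f v w z : fat W -> smooth_on W f -> nbhs z W ->
  derive_on W (v + w) f z = derive_on W v f z + derive_on W w f z.
Proof.
move=> fW sf /[dup] nWz /nbhs_singleton Wz.
apply: derive_onE => //; rewrite has_deriv_nbhs//.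
have [e e0 We] := nbhs_ballW nWz.
have hv := smooth_has_deriv (v := v) sf Wz; rewrite has_deriv_nbhs// in hv.
(* Split the increment at [z + h v]: the first part is the difference quotient
   along [v], the second is a value of the derivative along [w] near [z]. *)
suff hw : (h^-1 * (f (z + h *: v + h *: w) - f (z + h *: v))) @[h --> (0 : R)^'] -->
   derive_on W w f z.
  apply: cvg_trans (cvgD hv hw); apply: near_eq_cvg.
  near=> h; transitivity (diff_quot f v z h + h^-1 * (f (z + h *: v + h *: w) - f (z + h *: v))) => //.
  by rewrite /diff_quot scalerDr addrA; ring.
apply/cvgrPdist_le => eps eps0.
have cw := smooth_cvg (smooth_derive_on w sf) Wz.
move/cvgrPdist_le : cw => /(_ eps eps0); rewrite near_withinE.
move=> /nbhs_ballW[d d0 Hd].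
pose c := `|v| + `|w| + 1.
have c0 : 0 < c by rewrite /c; have := normr_ge0 v; have := normr_ge0 w; lra.
near=> h.
have h0 : h != 0 by near: h; exact: nbhs_dnbhs_neq.
have hd : `|h| * c < d.
  rewrite -ltr_pdivlMr//; near: h; apply: near0_lt; exact: divr_gt0.
have he : `|h| * c < e.
  rewrite -ltr_pdivlMr//; near: h; apply: near0_lt; exact: divr_gt0.
have bnd (s : R) : 0 <= s <= 1 -> `|z + h *: v + s *: (h *: w) - z| <= `|h| * c.
  move=> /andP[s0 s1]; rewrite addrAC [z + _ - z]addrAC subrr add0r (le_trans (ler_normD _ _))//.
  rewrite !normrZ (ger0_norm s0) /c !mulrDr mulr1 -addrA lerD2l.
  rewrite -[X in X <= _]addr0 lerD//.
  by rewrite -[X in _ <= X]mul1r ler_wpM2r// mulr_ge0.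
have [|s /andP[s0 s1] ->] := @segment_MVT W (h *: w) f (z + h *: v) sf.
  by move=> s s01; apply: We; apply: le_lt_trans he; exact: bnd.
have s01 : 0 <= s <= 1 by rewrite !ltW.
have Ws : W (z + h *: v + s *: (h *: w)).
  by apply: We; apply: le_lt_trans he; exact: bnd.
rewrite derive_onZ// mulKf//; apply: Hd => //.
by apply: le_lt_trans hd; exact: bnd.
Unshelve. all: by end_near. Qed.

Lemma smooth_sub W (O : set V) f : fat O -> O `<=` W -> smooth_on W f -> smooth_on O f.
Proof.
by move=> fO OW sf; apply: (@smooth_affine _ _ _ O W id id) => //; [move=> z; exact: cvg_id].
Qed.

Lemma derive_on_sub W (O : set V) f v z : fat O -> O `<=` W -> smooth_on W f -> O z ->
  derive_on O v f z = derive_on W v f z.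
Proof.
by move=> fO OW sf Oz; apply: (@derive_on_affine _ _ _ O W id id).
Qed.

(** A second difference is a mixed second derivative at an intermediate point. *)
Lemma second_difference W f a b z : open W -> smooth_on W f ->
  (forall s t : R, 0 <= s <= 1 -> 0 <= t <= 1 -> W (z + s *: a + t *: b)) ->
  exists s t : R, [/\ 0 < s < 1, 0 < t < 1 &
  f (z + a + b) - f (z + a) - (f (z + b) - f z) =
  derive_on W b (derive_on W a f) (z + s *: a + t *: b)].
Proof.
move=> oW sf Wab; have fW := fat_open oW.
pose A y := y + b.
have cA : continuous A by move=> y; apply: cvgD; [exact: cvg_id|exact: cvg_cst].
have affA y (k : R) u : A (y + k *: u) = A y + k *: u by rewrite /A addrAC.
pose W' := W `&` A @^-1` W.
have oW' : open W' by apply: openI => //; apply: open_comp => // y _; exact: cA.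
have fW' := fat_open oW'.
pose G y := f (A y) + -1 * f y.
have sfA : smooth_on W' (f \o A).
  by apply: (@smooth_affine _ _ _ W' W A id) => // y [].
have sG : smooth_on W' G.
  apply: smoothD => //; apply: smoothM => //; first exact: smooth_cst.
  by apply: (smooth_sub fW' _ sf) => y [].
have W's (s : R) : 0 <= s <= 1 -> W' (z + s *: a).
  move=> s01; split.
    by have := Wab s 0 s01; rewrite scale0r addr0 lexx ler01; apply.
  by have := Wab s 1 s01; rewrite scale1r lexx ler01; apply.
have [s s01 GE] := segment_MVT sG W's.
have s01' : 0 <= s <= 1 by move: s01 => /andP[? ?]; rewrite !ltW.
have [|t t01 DE] := @segment_MVT W b (derive_on W a f) (z + s *: a) (smooth_derive_on _ sf).
  by move=> t t01; exact: Wab.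
exists s, t; split => //; rewrite -DE.
have -> : f (z + a + b) - f (z + a) - (f (z + b) - f z) = G (z + a) - G z.
  by rewrite /G /A; ring.
rewrite GE; apply: derive_onE => //; first exact: W's.
have [Wz WAz] := W's s s01'.
rewrite -[- derive_on _ _ _ _]mulN1r.
apply: has_derivD.
  apply: (@has_deriv_affine _ _ _ W' W A id) => //; first by move=> y [].
  exact: smooth_has_deriv.
rewrite -[X in has_deriv _ _ _ _ X]add0r -[X in has_deriv _ _ _ _ (X + _)](mul0r (f (z + s *: a))).
apply: has_derivM; first exact: has_deriv_cst.
apply: (@has_deriv_affine _ _ _ W' W id id) => //; first by move=> y [].
exact: smooth_has_deriv.
Qed.

(** The second difference is symmetric in the two directions, so values of both
    mixed derivatives at points close to [z] coincide. *)
Lemma derive_on_comm_open W f v w z : open W -> smooth_on W f -> W z ->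
  derive_on W v (derive_on W w f) z = derive_on W w (derive_on W v f) z.
Proof.
move=> oW sf Wz; have fW := fat_open oW.
have nWz : nbhs z W by exact: open_nbhs_nbhs.
have [e e0 We] := nbhs_ballW nWz.
pose c := `|v| + `|w| + 1.
have c0 : 0 < c by rewrite /c; have := normr_ge0 v; have := normr_ge0 w; lra.
have bnd (h s t : R) : 0 < h -> 0 <= s <= 1 -> 0 <= t <= 1 ->
    `|z + s *: (h *: v) + t *: (h *: w) - z| <= h * c.
  move=> h0 /andP[s0 s1] /andP[t0 t1].
  rewrite addrAC [z + _ - z]addrAC subrr add0r (le_trans (ler_normD _ _))//.
  rewrite !normrZ (ger0_norm s0) (ger0_norm t0) (ger0_norm (ltW h0)) /c !mulrDr mulr1.
  have := mulr_ge0 (ltW h0) (normr_ge0 v); have := mulr_ge0 (ltW h0) (normr_ge0 w).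
  nra.
have scale a b (h : R) y : W y ->
    derive_on W (h *: b) (derive_on W (h *: a) f) y = h ^+ 2 * derive_on W b (derive_on W a f) y.
  move=> Wy; rewrite (@eq_derive_on _ _ W setT _ _ (fun y => h * derive_on W a f y))//; first last.
  - by move=> x Wx _; exact: derive_onZ.
  - exact: openT.
  apply: derive_onE => //.
  have := has_derivZ (c := h) (has_derivM (has_deriv_cst W b h y)
    (smooth_has_deriv (v := b) (smooth_derive_on a sf) Wy)).
  by rewrite mul0r add0r mulrA expr2.
apply/eqP; rewrite -subr_eq0 -normr_le0; apply/ler_addgt0Pl => eps eps0; rewrite addr0.
have eps2 : 0 < eps / 2 by rewrite divr_gt0.
have near_val a b : exists2 d : R, 0 < d & forall y, `|y - z| < d -> W y ->
    `|derive_on W b (derive_on W a f) z - derive_on W b (derive_on W a f) y| <= eps / 2.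
  have := smooth_cvg (smooth_derive_on b (smooth_derive_on a sf)) Wz.
  by move=> /cvgrPdist_le /(_ _ eps2); rewrite near_withinE => /nbhs_ballW.
have [d1 d10 H1] := near_val v w; have [d2 d20 H2] := near_val w v.
pose h := Num.min e (Num.min d1 d2) / (2 * c).
have m0 : 0 < Num.min e (Num.min d1 d2) by rewrite !lt_min e0 d10 d20.
have h0 : 0 < h by rewrite /h divr_gt0// mulr_gt0.
have hc : h * c < Num.min e (Num.min d1 d2).
  rewrite /h invfM mulrA mulfVK ?gt_eqF//; lra.
move: hc; rewrite !lt_min => /and3P[he hd1 hd2].
have Wvw (s t : R) : 0 <= s <= 1 -> 0 <= t <= 1 -> W (z + s *: (h *: v) + t *: (h *: w)).
  by move=> s01 t01; apply: We; apply: le_lt_trans he; exact: bnd.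
have Wwv (s t : R) : 0 <= s <= 1 -> 0 <= t <= 1 -> W (z + s *: (h *: w) + t *: (h *: v)).
  by move=> s01 t01; rewrite addrAC; exact: Wvw.
have [s1 [t1 [/andP[? ?] /andP[? ?] E1]]] := second_difference oW sf Wvw.
have [s2 [t2 [/andP[? ?] /andP[? ?] E2]]] := second_difference oW sf Wwv.
move: E1; rewrite scale; last by apply: Wvw; rewrite !ltW.
rewrite (_ : f _ - _ - _ = f (z + h *: w + h *: v) - f (z + h *: w) - (f (z + h *: v) - f z));
  last by rewrite [z + _ + _]addrAC; ring.
rewrite E2 scale; last by apply: Wwv; rewrite !ltW.
have hh : h ^+ 2 != 0 by rewrite expf_neq0// gt_eqF.
move=> /(mulfI hh) E.
have b1 : `|z + s1 *: (h *: v) + t1 *: (h *: w) - z| <= h * c by apply: bnd; rewrite ?ltW.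
have b2 : `|z + s2 *: (h *: w) + t2 *: (h *: v) - z| <= h * c.
  by rewrite [z + _ + _]addrAC; apply: bnd; rewrite ?ltW.
have W1 : W (z + s1 *: (h *: v) + t1 *: (h *: w)) by apply: Wvw; apply/andP; split; exact: ltW.
have W2 : W (z + s2 *: (h *: w) + t2 *: (h *: v)) by apply: Wwv; apply/andP; split; exact: ltW.
have := H1 _ (le_lt_trans b1 hd1) W1; rewrite -E => K1.
have K2 := H2 _ (le_lt_trans b2 hd2) W2.
move: K1 K2; rewrite !ler_norml => /andP[? ?] /andP[? ?]; apply/andP; split; lra.
Qed.

(** Mixed derivatives commute at interior points. *)
Lemma derive_on_comm W f v w z : smooth_on W f -> nbhs z W ->
  derive_on W v (derive_on W w f) z = derive_on W w (derive_on W v f) z.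
Proof.
move=> sf nWz; pose O := W°.
have oO : open O := open_interior _.
have Oz : O z by [].
have OW : O `<=` W := @interior_subset _ _.
have fO := fat_open oO.
have E a b : derive_on W a (derive_on W b f) z = derive_on O a (derive_on O b f) z.
  rewrite -(derive_on_sub a fO OW (smooth_derive_on _ sf) Oz).
  apply: (@eq_derive_on _ _ O setT) => //; first exact: openT.
  by move=> y Oy _; rewrite (derive_on_sub b fO OW sf Oy).
by rewrite !E; apply: derive_on_comm_open => //; exact: smooth_sub sf.
Qed.

End MeanValue.

(** * Integrals depending on a parameter *)

Section IntervalIntegral.
Context {R : realType}.
Implicit Types (a b t : R) (f g F : R -> R).
Local Notation mu := (@lebesgue_measure R).

(** The Lebesgue integral over the segment [a, b]. *)
Definition itv_integral a b f := Rintegral mu `[a, b] f.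

Lemma integrable_itv a b f : {within `[a, b], continuous f} ->
  mu.-integrable `[a, b] (EFin \o f).
Proof. by move=> cf; apply: continuous_compact_integrable => //; exact: segment_compact. Qed.

Lemma integrable_itv_oo a b f : {within `[a, b], continuous f} ->
  mu.-integrable `]a, b[ (EFin \o f).
Proof.
move=> /integrable_itv; apply: integrableS => //.
by move=> t /=; rewrite !in_itv /= => /andP[? ?]; rewrite !ltW.
Qed.

Lemma integral_oo a b f : mu.-integrable `]a, b[ (EFin \o f) ->
  itv_integral a b f = Rintegral mu `]a, b[ f.
Proof.
by move=> /integrableP[mf _]; rewrite /itv_integral /Rintegral integral_itv_bndoo.
Qed.

(** The end points do not contribute to the integral. *)
Lemma eq_integral_oo a b f g : {within `[a, b], continuous f} ->
  (forall t, a < t < b -> f t = g t) -> itv_integral a b f = itv_integral a b g.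
Proof.
move=> /integrable_itv_oo fi fg.
have gi : mu.-integrable `]a, b[ (EFin \o g).
  apply: eq_integrable fi => // t /set_mem /=; rewrite in_itv /= => tab.
  by rewrite /= fg.
rewrite !integral_oo//; apply: eq_Rintegral => t /set_mem /=.
by rewrite in_itv /=; exact: fg.
Qed.

Lemma itv_integralD a b f g : {within `[a, b], continuous f} -> {within `[a, b], continuous g} ->
  itv_integral a b (fun t => f t + g t) = itv_integral a b f + itv_integral a b g.
Proof. by move=> cf cg; apply: RintegralD => //; exact: integrable_itv. Qed.

Lemma itv_integralB a b f g : {within `[a, b], continuous f} -> {within `[a, b], continuous g} ->
  itv_integral a b (fun t => f t - g t) = itv_integral a b f - itv_integral a b g.
Proof. by move=> cf cg; apply: RintegralB => //; exact: integrable_itv. Qed.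

Lemma itv_integralZ a b (c : R) f : {within `[a, b], continuous f} ->
  itv_integral a b (fun t => c * f t) = c * itv_integral a b f.
Proof. by move=> cf; apply: RintegralZl => //; exact: integrable_itv. Qed.

Lemma integral_le01 f (e : R) : {within `[0, 1], continuous f} ->
  (forall t, 0 < t < 1 -> `|f t| <= e) -> `|itv_integral 0 1 f| <= e.
Proof.
move=> /integrable_itv_oo fi fe; rewrite integral_oo//.
apply: le_trans (le_normr_Rintegral _ fi) _ => //.
have -> : e = Rintegral mu `]0, 1[ (cst e).
  rewrite Rintegral_cst//= lebesgue_measure_itv/= lte_fin ltr01 oppr0 adde0 /=.
  by rewrite mulr1.
apply: le_Rintegral => //.
- exact: (integrable_norm fi).
- by apply: integrable_itv_oo => t; exact: cvg_cst.
Qed.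

Lemma integral_FTC a b f F : a < b -> {within `[a, b], continuous f} ->
  {within `[a, b], continuous F} -> (forall t, a < t < b -> is_derive t 1 F (f t)) ->
  itv_integral a b f = F b - F a.
Proof.
move=> ab cf /(continuous_within_itvP _ ab)[_ Fa Fb] dF.
rewrite /itv_integral /Rintegral (@continuous_FTC2 _ f F)//.
- split => // t; rewrite in_itv /= => tab; by have := dF t tab.
- move=> t; rewrite in_itv /= => tab; rewrite derive1E; by have [_ ->] := dF t tab.
Qed.

Lemma integral_affine a b f : a < b -> {within `[a, b], continuous f} ->
  itv_integral a b f = itv_integral 0 1 (fun t => (b - a) * f (a + t * (b - a))).
Proof.
move=> ab cf; pose F t := a + t * (b - a).
have F0 : F 0 = a by rewrite /F; ring.
have F1 : F 1 = b by rewrite /F; ring.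
have dF t : is_derive t 1 F (b - a).
  rewrite /F; apply: is_derive_eq; rewrite /GRing.scale/=; ring.
have F'E : derive1 F = cst (b - a).
  by apply/funext => t; rewrite derive1E; have [_ ->] := dF t.
have cF : continuous F.
  by move=> t; apply: differentiable_continuous; apply/derivable1_diffP; have [] := dF t.
rewrite /itv_integral /Rintegral -{1}F0 -{1}F1 integration_by_substitution_increasing.
- congr fine; apply: eq_integral => t _ /=.
  by rewrite F'E /= mulrC.
- exact: ler01.
- by move=> x y _ _ xy; rewrite /F ltrD2l ltr_pM2r// subr_gt0.
- by rewrite F'E => t _; exact: cvg_cst.
- by rewrite F'E; exact: is_cvg_cst.
- by rewrite F'E; exact: is_cvg_cst.
- split.
  + by move=> t _; have [] := dF t.
  + exact: (cvg_at_right_filter (cF 0)).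
  + exact: (cvg_at_left_filter (cF 1)).
- by rewrite F0 F1.
Qed.

End IntervalIntegral.

Section ParameterIntegral.
Context {R : realType} {E V : normedModType R}.

(** Compactness of [0, 1]: continuity in [q] is uniform in [t]. *)
Lemma near_uniform01 (U : set E) (c : R -> E -> R) (q : E) (eps : R) : U q -> 0 < eps ->
  (forall t : R, 0 <= t <= 1 ->
     c p.1 p.2 @[p --> within [set p : R * E | 0 <= p.1 <= 1 /\ U p.2] (nbhs (t, q))]
       --> c t q) ->
  \forall y \near q, U y -> forall t : R, 0 <= t <= 1 -> `|c t q - c t y| <= eps.
Proof.
move=> Uq eps0 cc.
have cpt : near_covering [set` `[(0 : R), 1]].
  by apply/compact_near_coveringP; exact: segment_compact.
have := cpt E (nbhs q) (fun y t => 0 <= t <= 1 -> U y -> `|c t q - c t y| <= eps) _.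
suff H : forall x : R, [set` `[0, 1]] x ->
    \forall x' \near x & i \near nbhs q, 0 <= x' <= 1 -> U i -> `|c x' q - c x' i| <= eps.
  move=> /(_ _ H) Hq; apply: (@filterS E (nbhs q) _ _ _ _ Hq) => y Hy Uy t t01.
  by apply: Hy => //; rewrite /= in_itv.
move=> t /=; rewrite in_itv /= => t01.
have e2 : 0 < eps / 2 by rewrite divr_gt0.
have := cc t t01 => /cvgrPdist_le /(_ _ e2); rewrite near_withinE.
move=> [[A B] /= [At Bq] AB]; exists (A, B) => // -[x y] /= [Ax By] x01 Uy.
have := AB (x, y) (conj Ax By) (conj x01 Uy) => /= K1.
have := AB (x, q) (conj Ax (nbhs_singleton Bq)) (conj x01 Uq) => /= K2.
move: K1 K2; rewrite !ler_norml => /andP[? ?] /andP[? ?]; apply/andP; split; lra.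
Qed.

(** A family of segments [al q + [0, 1] be q] in [W], depending affinely on the
    parameter [q] in the open set [U]; [al0] and [be0] are the linear parts of
    [al] and [be].  The end points of a segment may lie on the boundary of [W],
    its other points may not. *)
Variables (W : set V) (U : set E) (al be al0 be0 : E -> V).
Hypothesis affal : forall q h v, al (q + h *: v) = al q + h *: al0 v.
Hypothesis affbe : forall q h v, be (q + h *: v) = be q + h *: be0 v.
Hypothesis cal : continuous al.
Hypothesis cbe : continuous be.
Hypothesis fatW : fat W.
Hypothesis oU : open U.

(** The point at time [t] of the segment with parameter [q]. *)
Definition segment_point (t : R) (q : E) : V := al q + t *: be q.
Local Notation phi := segment_point.

Hypothesis phiW : forall (t : R) q, U q -> 0 <= t <= 1 -> W (phi t q).
Hypothesis phi_int : forall (t : R) q, U q -> 0 < t < 1 -> nbhs (phi t q) W.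

(** The powers of [t] make the class of integrals stable under
    differentiation: the segment point moves with velocity [al0 v + t be0 v]. *)
Definition par_integrand k (f : V -> R) t q := t ^+ k * f (phi t q).

Definition par_integral k (f : V -> R) q := itv_integral 0 1 (fun t => par_integrand k f t q).

Lemma phi_continuous : continuous (fun p : R * E => phi p.1 p.2).
Proof.
move=> [t q]; apply: cvgD.
  by apply: (cvg_comp _ _ cvg_snd); exact: cal.
apply: cvgZ; first exact: cvg_fst.
by apply: (cvg_comp _ _ cvg_snd); exact: cbe.
Qed.

Lemma par_integrand_cvg k f (t : R) q : smooth_on W f -> U q -> 0 <= t <= 1 ->
  par_integrand k f p.1 p.2 @[p --> within [set p : R * E | 0 <= p.1 <= 1 /\ U p.2] (nbhs (t, q))]
    --> par_integrand k f t q.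
Proof.
move=> sf Uq t01; apply: cvgM.
  apply: cvg_within_filter.
  apply: (@cvg_comp _ _ _ (fun p : R * E => p.1) (fun x : R => x ^+ k) _ (nbhs t)).
    exact: cvg_fst.
  exact: exprn_continuous.
have := @cvg_within_comp _ _ [set p : R * E | 0 <= p.1 <= 1 /\ U p.2] W
  (fun p => phi p.1 p.2) (t, q) (@phi_continuous _) _.
move=> H; apply: (cvg_comp _ _ (H _) (smooth_cvg sf (phiW Uq t01))).
by move=> [t' q'] /= [t'01 Uq']; exact: phiW.
Qed.

Lemma par_integrand_continuous k f q : smooth_on W f -> U q ->
  {within `[0, 1], continuous (fun t => par_integrand k f t q)}.
Proof.
move=> sf Uq; apply/subspace_continuousP => t; rewrite /= in_itv /= => t01.
have cq : {for t, continuous (fun t : R => (t, q))}.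
  exact: (cvg_pair (F := nbhs (t : R)) (f := id) (g := cst q) cvg_id (cvg_cst _)).
have := @cvg_within_comp R (R * E)%type [set` `[(0 : R), (1 : R)]] [set p : R * E | 0 <= p.1 <= 1 /\ U p.2] _ t cq.
move=> H; apply: (cvg_comp _ _ (H _) (@par_integrand_cvg k f t q sf Uq t01)).
by move=> x /=; rewrite in_itv.
Qed.

Lemma par_integral_continuous k f : smooth_on W f -> {within U, continuous (par_integral k f)}.
Proof.
move=> sf; apply/subspace_continuousP => q Uq; apply/cvgrPdist_le => eps eps0.
have := near_uniform01 Uq eps0 (fun t : R => @par_integrand_cvg k f t q sf Uq).
rewrite near_withinE; apply: filterS => y H Uy.
rewrite /from_subspace /par_integral -itv_integralB; try exact: par_integrand_continuous.
apply: integral_le01 => [|t /andP[? ?]]; last by apply: H => //; rewrite !ltW.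
by move=> t; apply: cvgB; exact: par_integrand_continuous.
Qed.

(** Differentiation under the integral sign. *)
Lemma has_deriv_par_integral k f q v : smooth_on W f -> U q ->
  has_deriv U v (par_integral k f) q
    (par_integral k (derive_on W (al0 v) f) q + par_integral k.+1 (derive_on W (be0 v) f) q).
Proof.
move=> sf Uq; have nU : nbhs q U by exact: open_nbhs_nbhs.
rewrite has_deriv_nbhs//; apply/cvgrPdist_le => eps eps0.
have e2 : 0 < eps / 2 by rewrite divr_gt0.
pose fa := derive_on W (al0 v) f; pose fb := derive_on W (be0 v) f.
have sa : smooth_on W fa by exact: smooth_derive_on.
have sb : smooth_on W fb by exact: smooth_derive_on.
have Ta := near_uniform01 Uq e2 (fun t : R => @par_integrand_cvg k fa t q sa Uq).
have Tb := near_uniform01 Uq e2 (fun t : R => @par_integrand_cvg k.+1 fb t q sb Uq).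
have [d d0 Hd] : exists2 d : R, 0 < d & forall y, `|y - q| < d ->
    [/\ U y, forall t : R, 0 <= t <= 1 -> `|par_integrand k fa t q - par_integrand k fa t y| <= eps / 2
      & forall t : R, 0 <= t <= 1 -> `|par_integrand k.+1 fb t q - par_integrand k.+1 fb t y| <= eps / 2].
  apply: nbhs_ballW; near=> y.
  have Uy : U y by near: y.
  by split => //; [apply: (near Ta y)|apply: (near Tb y)].
have c0 : 0 < `|v| + 1 by have := normr_ge0 v; lra.
near=> h.
have h0 : h != 0 by near: h; exact: nbhs_dnbhs_neq.
have hd : `|h| * (`|v| + 1) < d.
  by rewrite -ltr_pdivlMr//; near: h; apply: near0_lt; exact: divr_gt0.
have bnd (s : R) : 0 <= s <= 1 -> `|q + (s * h) *: v - q| < d.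
  move=> /andP[s0 s1]; apply: le_lt_trans hd.
  rewrite addrAC subrr add0r normrZ normrM (ger0_norm s0).
  have := mulr_ge0 (normr_ge0 h) (normr_ge0 v); have := normr_ge0 h; nra.
have Us (s : R) : 0 <= s <= 1 -> U (q + (s * h) *: v) by move=> /bnd /Hd[].
have Uh : U (q + h *: v) by have := Us 1; rewrite mul1r; apply; lra.
have cf y : U y -> {within `[0, 1], continuous (fun t => par_integrand k f t y)}.
  by move=> Uy; exact: par_integrand_continuous.
have ca : {within `[0, 1], continuous (fun t => par_integrand k fa t q)}.
  exact: par_integrand_continuous.
have cb : {within `[0, 1], continuous (fun t => par_integrand k.+1 fb t q)}.
  exact: par_integrand_continuous.
have cab : {within `[0, 1], continuous (fun t => par_integrand k fa t q + par_integrand k.+1 fb t q)}.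
  by move=> t; apply: cvgD; [exact: ca|exact: cb].
have cdf : {within `[0, 1], continuous (fun t => par_integrand k f t (q + h *: v) - par_integrand k f t q)}.
  by move=> t; apply: cvgB; exact: cf.
have cdq : {within `[0, 1], continuous (fun t => h^-1 * (par_integrand k f t (q + h *: v) - par_integrand k f t q))}.
  by move=> t; apply: cvgM; [exact: cvg_cst|exact: cdf].
rewrite /diff_quot /par_integral -itv_integralD// -itv_integralB//; try exact: cf.
rewrite -itv_integralZ// -itv_integralB//.
apply: integral_le01 => [|t t01].
  by move=> t; apply: cvgB; [exact: cab|exact: cdq].
have t01' : 0 <= t <= 1 by move: t01 => /andP[? ?]; rewrite !ltW.
pose w := al0 v + t *: be0 v.
have phi_aff (s : R) : phi t (q + s *: v) = phi t q + s *: w.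
  by rewrite /segment_point affal affbe /w !scalerDr !scalerA [t * s]mulrC addrACA.
have [s|s s01 D] := segment_MVT (W := W) (w := h *: w) (z := phi t q) sf.
  by move=> s01; rewrite scalerA -phi_aff; apply: phiW => //; exact: Us.
have s01' : 0 <= s <= 1 by move: s01 => /andP[? ?]; rewrite !ltW.
(* The mean value theorem is applied in [W] along the straight path of the
   segment point. *)
have {D} : f (phi t (q + h *: v)) - f (phi t q) =
    h * (fa (phi t (q + (s * h) *: v)) + t * fb (phi t (q + (s * h) *: v))).
  rewrite phi_aff D scalerA -phi_aff.
  have nW : nbhs (phi t (q + (s * h) *: v)) W by apply: phi_int => //; exact: Us.
  have Wp := nbhs_singleton nW.
  by rewrite derive_onZ// derive_onD// derive_onZ.
move=> D; have [_ /(_ _ t01') Ka /(_ _ t01') Kb] := Hd _ (bnd s s01').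
have -> : h^-1 * (par_integrand k f t (q + h *: v) - par_integrand k f t q) =
   par_integrand k fa t (q + (s * h) *: v) + par_integrand k.+1 fb t (q + (s * h) *: v).
  by rewrite /par_integrand -mulrBr D exprSr; field.
move: Ka Kb; rewrite !ler_norml => /andP[? ?] /andP[? ?]; apply/andP; split; lra.
Unshelve. all: by end_near. Qed.

(** Sums of parameter integrals of smooth functions. *)
Inductive par_span : (E -> R) -> Prop :=
| par_base k f : smooth_on W f -> par_span (par_integral k f)
| par_add f g : par_span f -> par_span g -> par_span (fun q => f q + g q).

Lemma par_integral_smooth k f : smooth_on W f -> smooth_on U (par_integral k f).
Proof.
move=> sf; apply: (@smooth_coind _ _ U par_span); last by constructor.
- move=> g; elim => {sf}[j {}f sf|g1 g2 _ c1 _ c2]; first exact: par_integral_continuous.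
  by move=> z; apply: cvgD; [exact: c1|exact: c2].
- move=> g v; elim => {sf}[j {}f sf|g1 g2 _ [h1 s1 d1] _ [h2 s2 d2]].
    exists (fun q => par_integral j (derive_on W (al0 v) f) q +
                     par_integral j.+1 (derive_on W (be0 v) f) q).
      by apply: par_add; apply: par_base; exact: smooth_derive_on.
    by move=> z Uz; exact: has_deriv_par_integral.
  exists (fun q => h1 q + h2 q); first exact: par_add.
  by move=> z Uz; apply: has_derivD; [exact: d1|exact: d2].
- exact: fat_open.
Qed.

End ParameterIntegral.

(** * Arcs, lifts and the cut space *)

Lemma derive_on_shift (R : realType) (V : normedModType R) (W : set V) v (f : V -> R) c z :
  (forall y, W (y + c) = W y) -> (forall y, f (y + c) = f y) ->
  derive_on W v f (z + c) = derive_on W v f z.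
Proof.
move=> Wc fc; rewrite /derive_on.
have -> : within_step W v (z + c) = within_step W v z.
  rewrite /within_step (_ : [set h | W (z + c + h *: v)] = [set h | W (z + h *: v)])//.
  by apply/funext => h /=; rewrite addrAC Wc.
have -> // : diff_quot f v (z + c) = diff_quot f v z.
by apply/funext => h; rewrite /diff_quot addrAC !fc.
Qed.

Lemma fat_itv (R : realType) (a b : R) : a < b -> @fat R R^o [set` `[a, b]].
Proof.
move=> ab z v /=; rewrite in_itv /= => /andP[az zb].
split; last exact: within_step_filter.
rewrite /within_step /within /= => H.
have H' : \forall h \near (0 : R), h != 0 -> ~ (a <= z + h * v <= b).
  by apply: (@filterS R (nbhs (0 : R)) _ _ _ _ H) => h /= Hh h0 zh; apply: (Hh h0); rewrite in_itv.
have [e e0 He] := nbhs_ballW (V := R^o) H'.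
pose d := Num.min (e / 2) ((b - a) / 2 / (`|v| + 1)).
have v1 : 0 < `|v| + 1 by have := normr_ge0 v; lra.
have d0 : 0 < d by rewrite /d lt_min !divr_gt0//; lra.
have de : d < e by rewrite /d gt_min; apply/orP; left; lra.
have dv : `|d * v| <= (b - a) / 2.
  have d1 : d * (`|v| + 1) <= (b - a) / 2.
    by rewrite -ler_pdivlMr// /d ge_min lexx orbT.
  by rewrite normrM gtr0_norm//; lra.
have dn : d != 0 by rewrite gt_eqF.
(* One of the steps [d] and [- d] does not leave the segment. *)
have [sgn|sgn] : (a <= z + d * v <= b) \/ (a <= z + - d * v <= b).
- move: dv; rewrite ler_norml => /andP[dv1 dv2].
  have [v0|v0] := leP 0 (d * v); have [zm|zm] := leP z ((a + b) / 2);
    by [left; lra|right; lra].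
- by apply: (He d) => //; rewrite subr0 gtr0_norm.
- by apply: (He (- d)) => //; rewrite ?oppr_eq0// subr0 normrN gtr0_norm.
Qed.

(** The partial derivative along the circle on the i-th cut component.  It is
    locked, as unification would otherwise unfold limits. *)
HB.lock Definition d_x (R : realType) (m : nat) (i : 'I_m.+1)
    (f : R^o * 'rV[R]_m.+1 -> R) : R^o * 'rV[R]_m.+1 -> R :=
  derive_on (cut_component i) ((1, 0) : R^o * 'rV[R]_m.+1) f.

(** The derivative along the constant vector [X] of the base. *)
HB.lock Definition d_base (R : realType) (m : nat) (i : 'I_m.+1) (X : 'rV[R]_m.+1)
    (f : R^o * 'rV[R]_m.+1 -> R) : R^o * 'rV[R]_m.+1 -> R :=
  derive_on (cut_component i) ((0, X) : R^o * 'rV[R]_m.+1) f.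

Section Lifts.
Context {R : realType} {m : nat}.
Local Notation n := m.+1.
Implicit Types (q : 'rV[R]_n) (i j : 'I_n) (k x : R).
Local Notation V := (R^o * 'rV[R]_n)%type.

Lemma to_circleD x k : k \is a Num.int -> to_circle (x + k) = to_circle x.
Proof. by move=> kZ; apply/to_circleP; rewrite addrC addKr. Qed.

Lemma to_conf_shift q k : k \is a Num.int -> to_conf (q + const_mx k) = to_conf q.
Proof. by move=> kZ; apply/funext => i; rewrite /to_conf !mxE to_circleD. Qed.

Lemma arc_end_shift q k i : arc_end (q + const_mx k) i = arc_end q i + k.
Proof. by rewrite /arc_end !mxE addrAC. Qed.

Lemma lift_domain_shift q k : lift_domain (q + const_mx k) = lift_domain q.
Proof.
by apply/propext; split => H i; have := H i; rewrite arc_end_shift !mxE ltrD2r.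
Qed.

Lemma cut_component_shift i (z : V) k :
  cut_component i (z + (k, const_mx k)) = cut_component i z.
Proof.
rewrite /cut_component /=; apply/propext.
by rewrite lift_domain_shift arc_end_shift !mxE !lerD2r.
Qed.

(** The break points listed in increasing order, starting at [q 0 ord0] and
    ending with its translate by one period. *)
Definition break_point q (k : nat) : R :=
  if (k < n)%N then q 0 (inord k) else q 0 ord0 + 1.

Lemma break_point_ord q i : break_point q i = q 0 i.
Proof. by rewrite /break_point ltn_ord inord_val. Qed.

Lemma break_pointS q i : break_point q i.+1 = arc_end q i.
Proof.
rewrite /break_point /arc_end; case: (ltngtP i.+1 n) (ltn_ord i) => // [lt _|eq _].
  rewrite addr0; congr (q 0 _); apply/val_inj => /=.
  by rewrite inordK ?modn_small.
by congr (q 0 _ + _); apply/val_inj => /=; rewrite eq modnn.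
Qed.

Lemma break_point_lt q (j k : nat) : lift_domain q -> (j < k <= n)%N ->
  break_point q j < break_point q k.
Proof.
move=> Uq /andP[jk kn].
have step a : (a < n)%N -> break_point q a < break_point q a.+1.
  move=> an; have := Uq (Ordinal an).
  by rewrite -break_pointS -break_point_ord.
elim: k jk kn => // k IH; rewrite ltnS leq_eqVlt => /predU1P[-> kn|jk kn]; first exact: step.
by apply: lt_trans (IH jk (ltnW kn)) (step _ kn).
Qed.

Lemma break_point_le q (j k : nat) : lift_domain q -> (j <= k <= n)%N ->
  break_point q j <= break_point q k.
Proof.
move=> Uq /andP[]; rewrite leq_eqVlt => /predU1P[->//|jk kn].
by rewrite ltW// break_point_lt// jk.
Qed.

Lemma break_point_n q : break_point q n = q 0 ord0 + 1.
Proof. by rewrite /break_point ltnn. Qed.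

Lemma break_bounds q i : lift_domain q -> q 0 ord0 <= q 0 i < q 0 ord0 + 1.
Proof.
move=> Uq; rewrite -break_point_n -(break_point_ord q ord0) -(break_point_ord q i).
apply/andP; split; first by apply: break_point_le => //=; rewrite ltnW.
by apply: break_point_lt; rewrite ?ltn_ord ?leqnn.
Qed.

Lemma arc_end_bound q i : lift_domain q -> arc_end q i <= q 0 i + 1.
Proof.
move=> Uq; rewrite -break_pointS; apply: (@le_trans _ _ (q 0 ord0 + 1)).
  by rewrite -break_point_n; apply: break_point_le; rewrite ?ltn_ord ?leqnn.
by rewrite lerD2r; have /andP[] := break_bounds i Uq.
Qed.

Lemma int_lt1_eq0 k : k \is a Num.int -> `|k| < 1 -> k = 0.
Proof.
move=> /intrP[z ->]; rewrite -intr_norm -[1]/(1%:~R) ltr_int => z1.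
by move: z1; rewrite -[X in _ < X]add0r ltzD1 normr_le0 => /eqP ->.
Qed.

(** Two lifts of one configuration differ by an integer translation: their
    coordinates differ by integers, and all coordinates of a lift lie in an
    interval of length one. *)
Lemma to_conf_inj_mod q q' : lift_domain q -> lift_domain q' -> to_conf q = to_conf q' ->
  exists2 k, k \is a Num.int & q = q' + const_mx k.
Proof.
move=> Uq Uq' E.
have dZ i : q 0 i - q' 0 i \is a Num.int.
  by apply/to_circleP; exact: (congr1 (fun p => p i) E).
exists (q 0 ord0 - q' 0 ord0) => //.
apply/rowP => i; rewrite !mxE.
have /eqP : (q 0 i - q' 0 i) - (q 0 ord0 - q' 0 ord0) = 0.
  apply: int_lt1_eq0; first by rewrite rpredB.
  have /andP[? ?] := break_bounds i Uq; have /andP[? ?] := break_bounds i Uq'.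
  rewrite ltr_norml; lra.
rewrite subr_eq0 => /eqP D; lra.
Qed.

Lemma liftP (p : conf R n) : B p -> lift_domain (lift p) /\ to_conf (lift p) = p.
Proof.
move=> [q Uq qp]; rewrite /lift.
exact: (@xgetPex _ 0 [set q | lift_domain q /\ to_conf q = p] (ex_intro _ q (conj Uq qp))).
Qed.

Lemma lift_to_conf q : lift_domain q ->
  exists2 k, k \is a Num.int & lift (to_conf q) = q + const_mx k.
Proof.
move=> Uq; have [UL E] := @liftP (to_conf q) (ex_intro2 _ _ q Uq erefl).
exact: to_conf_inj_mod.
Qed.

Lemma coord_cont (j : 'I_n) : continuous (fun q : 'rV[R]_n => q 0 j).
Proof. exact: coord_continuous. Qed.

Lemma arc_end_cont i : continuous (fun q : 'rV[R]_n => arc_end q i).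
Proof.
by move=> q; have h := @coord_cont (ordS i) q; exact: (cvgD h (cvg_cst _)).
Qed.

Lemma open_lt (T : topologicalType) (f g : T -> R) : continuous f -> continuous g ->
  open [set z | f z < g z].
Proof.
move=> cf cg; rewrite (_ : [set z | _] = (fun z => g z - f z) @^-1` [set y | 0 < y]).
  apply: open_comp; last exact: open_gt.
  by move=> z _; apply: cvgB; [exact: cg|exact: cf].
by apply/seteqP; split => z /=; rewrite subr_gt0.
Qed.

Lemma open_lift_domain : open (@lift_domain R n).
Proof.
rewrite openE => q Uq.
suff : nbhs q (fun q' : 'rV[R]_n => forall i, q' 0 i < arc_end q' i) by [].
apply: (@filter_forall _ 'I_n (fun i (q' : 'rV[R]_n) => q' 0 i < arc_end q' i) (nbhs q) _) => i; apply: open_nbhs_nbhs; split; last exact: Uq.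
exact: open_lt (@coord_cont i) (@arc_end_cont i).
Qed.

(** The interior of the cut component. *)
Definition open_cell i : set V :=
  [set z | lift_domain z.2 /\ z.2 0 i < z.1 < arc_end z.2 i].

Lemma snd_comp_cont (T : topologicalType) (f : 'rV[R]_n -> T) : continuous f -> continuous (fun z : V => f z.2).
Proof. by move=> cf z; apply: (cvg_comp _ _ cvg_snd); exact: cf. Qed.

Lemma open_open_cell i : open (open_cell i).
Proof.
rewrite (_ : open_cell i = (fun z : V => z.2) @^-1` (@lift_domain R n) `&`
   ([set z : V | z.2 0 i < z.1] `&` [set z : V | z.1 < arc_end z.2 i])).
  apply: openI; first by apply: open_comp open_lift_domain => z _; exact: cvg_snd.
  have c1 : continuous (fun z : V => z.1) by move=> z; exact: cvg_fst.
  apply: openI; first exact: (open_lt (snd_comp_cont (@coord_cont i)) c1).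
  exact: (open_lt c1 (snd_comp_cont (@arc_end_cont i))).
apply/seteqP; split => z /=; first by move=> [? /andP[]].
by move=> [? [? ?]]; split => //; apply/andP.
Qed.

Lemma open_cell_interior i (z : V) : open_cell i z -> nbhs z (cut_component i).
Proof.
move=> Oz; apply: (@filterS _ (nbhs z) _ (open_cell i)); last first.
  by apply: open_nbhs_nbhs; split => //; exact: open_open_cell.
by move=> y [? /andP[? ?]]; split => //; rewrite !ltW.
Qed.

(** The cut component is locally a half-space: since the arc has positive
    length, at most one of its two boundary inequalities is an equality at a
    given point, so a small step along [v] or along [- v] stays inside. *)
Lemma fat_cut_component i : fat (@cut_component R n i).
Proof.
move=> z v [Uz /andP[z1 z2]].
have nU : \forall h \near (0 : R), lift_domain (z + h *: v).2.
  have oU : open ((fun z : V => z.2) @^-1` (@lift_domain R n)).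
    by apply: open_comp open_lift_domain => y _; exact: cvg_snd.
  exact: (step_cvg v (open_nbhs_nbhs (conj oU Uz))).
split; last exact: within_step_filter.
rewrite /within_step /within /= => H.
have H' : \forall h \near (0 : R), h != 0 -> ~ ((z + h *: v).2 0 i <= (z + h *: v).1 <= arc_end (z + h *: v).2 i).
  near=> h => h0 zh.
  have HH : h != 0 -> cut_component i (z + h *: v) -> False by near: h; exact: H.
  by apply: HH => //; split; [near: h|exact: zh].
have [e e0 He] := nbhs_ballW (V := R^o) H'.
(* Along the step [h], the distance [y] to the initial point of the arc and the
   length [l] of the arc become [y + h y'] and [l + h l']. *)
pose y := z.1 - z.2 0 i; pose l := arc_end z.2 i - z.2 0 i.
pose y' := v.1 - v.2 0 i; pose l' := v.2 0 (ordS i) - v.2 0 i.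
have l0 : 0 < l by rewrite /l subr_gt0.
pose c := `|y'| + `|l'| + 1.
have c0 : 0 < c by have := normr_ge0 y'; have := normr_ge0 l'; rewrite /c; lra.
pose d := Num.min (e / 2) (l / 2 / c).
have d0 : 0 < d by rewrite /d lt_min !divr_gt0.
have de : d < e by rewrite /d gt_min; apply/orP; left; lra.
have dn : d != 0 by rewrite gt_eqF.
have dc : d * `|y'| + d * `|l'| + d <= l / 2.
  have : d * c <= l / 2 by rewrite -ler_pdivlMr// /d ge_min lexx orbT.
  by rewrite /c !mulrDr mulr1.
have [P1 P2] : `|d * y'| <= d * `|y'| /\ `|d * l'| <= d * `|l'|.
  by rewrite !normrM (gtr0_norm d0).
move: P1 P2; rewrite !ler_norml => /andP[P1 P2] /andP[P3 P4].
have test h : 0 <= y + h * y' <= l + h * l' ->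
    (z + h *: v).2 0 i <= (z + h *: v).1 <= arc_end (z + h *: v).2 i.
  rewrite /arc_end /= !mxE /GRing.scale /= /y /l /y' /l' /arc_end; lra.
have y0 : 0 <= y by rewrite /y subr_ge0.
have yl : y <= l by rewrite /y /l lerD2r.
have [sgn|sgn] : (0 <= y + d * y' <= l + d * l') \/ (0 <= y + - d * y' <= l + - d * l').
- have [yl2|yl2] := leP y (l / 2).
    have [|] := leP 0 (d * y'); [left|right]; lra.
  have [|] := leP (d * (y' - l')) 0; [left|right]; lra.
- by apply: (He d) => //; [rewrite subr0 gtr0_norm|exact: test].
- by apply: (He (- d)) => //; [rewrite subr0 normrN gtr0_norm|rewrite oppr_eq0|exact: test].
Unshelve. all: by end_near. Qed.

(** The i-th arc over [q] is parametrized by [t |-> base_pt i q + t *: arc_dir i q],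
    with [t] in [0, 1]; [arc_dir0] is the linear part of [arc_dir]. *)
Definition arc_length q i := arc_end q i - q 0 i.
Definition base_pt i q : V := (q 0 i, q).
Definition arc_dir i q : V := (arc_length q i, 0).
Definition arc_dir0 i q : V := (q 0 (ordS i) - q 0 i, 0).

Lemma arc_length_gt0 q i : lift_domain q -> 0 < arc_length q i.
Proof. by move=> Uq; rewrite subr_gt0. Qed.

Lemma arc_point i (t : R) q :
  segment_point (base_pt i) (arc_dir i) t q = (q 0 i + t * arc_length q i, q).
Proof. by rewrite /segment_point /base_pt /arc_dir; congr pair; rewrite /= scaler0 addr0. Qed.

Lemma base_pt_affine i q h v : base_pt i (q + h *: v) = base_pt i q + h *: base_pt i v.
Proof. by rewrite /base_pt; congr pair; rewrite /= !mxE. Qed.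

Lemma arc_dir_affine i q h v : arc_dir i (q + h *: v) = arc_dir i q + h *: arc_dir0 i v.
Proof.
rewrite /arc_dir /arc_dir0 /arc_length /arc_end; congr pair; rewrite /= ?scaler0 ?addr0// !mxE.
rewrite /GRing.scale /=; ring.
Qed.

Lemma base_pt_cont i : continuous (base_pt i).
Proof. by move=> q; have h := @coord_cont i q; exact: (cvg_pair h cvg_id). Qed.

Lemma arc_length_cont i : continuous (fun q => arc_length q i).
Proof.
by move=> q; have h := @coord_cont i q; have h' := @arc_end_cont i q; exact: (cvgB h' h).
Qed.

Lemma arc_dir_cont i : continuous (arc_dir i).
Proof. by move=> q; have h := @arc_length_cont i q; exact: (cvg_pair h (cvg_cst _)). Qed.

Lemma arc_point_in i (t : R) q : lift_domain q -> 0 <= t <= 1 ->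
  cut_component i (segment_point (base_pt i) (arc_dir i) t q).
Proof.
move=> Uq /andP[t0 t1]; rewrite arc_point; split => //=.
have l0 := arc_length_gt0 i Uq.
have E : arc_end q i = q 0 i + arc_length q i by rewrite /arc_length addrC subrK.
by rewrite E lerDl lerD2l ger_pMl// t1 andbT mulr_ge0// ltW.
Qed.

Lemma arc_point_cell i (t : R) q : lift_domain q -> 0 < t < 1 ->
  open_cell i (segment_point (base_pt i) (arc_dir i) t q).
Proof.
move=> Uq /andP[t0 t1]; rewrite arc_point; split => //=.
have l0 := arc_length_gt0 i Uq.
have E : arc_end q i = q 0 i + arc_length q i by rewrite /arc_length addrC subrK.
by rewrite E ltrDl ltrD2l gtr_pMl// t1 andbT mulr_gt0.
Qed.

Lemma arc_point_int i (t : R) q : lift_domain q -> 0 < t < 1 ->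
  nbhs (segment_point (base_pt i) (arc_dir i) t q) (cut_component i).
Proof. by move=> Uq t01; apply: open_cell_interior; exact: arc_point_cell. Qed.

(** The integrand of [Omega i]. *)
Definition gf_density i (f g : V -> R) (z : V) : R :=
  d_x i f z * d_x i (d_x i g) z - d_x i (d_x i f) z * d_x i g z.

(** The length of the i-th arc, as a function on the cut component. *)
Definition length_fun i (z : V) : R := arc_length z.2 i.

(** The length is affine: its derivative is the difference of the velocities of
    the two ends. *)
Lemma has_deriv_length W i v (z : V) :
  has_deriv W v (length_fun i) z (v.2 0 (ordS i) - v.2 0 i).
Proof.
rewrite /has_deriv; apply: (@cvg_trans _ (cst (v.2 0 (ordS i) - v.2 0 i) @ within_step W v z)); last exact: cvg_cst.
apply: near_eq_cvg; near=> h.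
have h0 : h != 0 by near: h; exact: within_step_neq0.
rewrite /diff_quot /length_fun /arc_length /arc_end /= !mxE; field.
Unshelve. all: by end_near. Qed.

Lemma smooth_length i : smooth_on (cut_component i) (length_fun i).
Proof.
have fW := @fat_cut_component i.
pose L (j : 'I_n) (z : V) := z.2 0 j.
have sL j : smooth_on (cut_component i) (L j).
  apply: smooth_linear => //.
    by apply: (@snd_comp_cont _ (fun q : 'rV[R]_n => q 0 j)); exact: coord_cont.
  by move=> c y z; rewrite /L /= !mxE.
apply: (@eq_smooth_on _ _ _ (fun z => (L (ordS i) z + cst (i.+1 == n)%:R z) + cst (-1) z * L i z)).
  by move=> z _; rewrite /L /length_fun /arc_length /arc_end /=; ring.
apply: smoothD => //; first by apply: smoothD => //; exact: smooth_cst.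
by apply: smoothM => //; exact: smooth_cst.
Qed.

Lemma smooth_d_x i (f : V -> R) : smooth_on (cut_component i) f -> smooth_on (cut_component i) (d_x i f).
Proof. by rewrite d_x.unlock; exact: smooth_derive_on. Qed.

Lemma smooth_density i f g : smooth_on (cut_component i) f -> smooth_on (cut_component i) g ->
  smooth_on (cut_component i) (gf_density i f g).
Proof.
move=> sf sg; have fW := @fat_cut_component i.
apply: (@eq_smooth_on _ _ _ (fun z => d_x i f z * d_x i (d_x i g) z +
    cst (-1) z * (d_x i (d_x i f) z * d_x i g z))).
  by move=> z _; rewrite /gf_density /=; ring.
have [df dg] := (smooth_d_x sf, smooth_d_x sg).
have [ddf ddg] := (smooth_d_x df, smooth_d_x dg).
apply: smoothD => //; first exact: smoothM.
by apply: smoothM => //; [exact: smooth_cst|exact: smoothM].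
Qed.

(** The integral of [f] over the i-th arc above [q], in the parameter [t]. *)
Definition arc_integral i (f : V -> R) q : R :=
  par_integral (base_pt i) (arc_dir i) 0 (fun z => length_fun i z * f z) q.

Lemma smooth_arc_integral i f : smooth_on (cut_component i) f ->
  smooth_on (@lift_domain R n) (arc_integral i f).
Proof.
move=> sf.
apply: (@par_integral_smooth _ _ _ (cut_component i) _ _ _ (base_pt i) (arc_dir0 i)).
- exact: base_pt_affine.
- exact: arc_dir_affine.
- exact: base_pt_cont.
- exact: arc_dir_cont.
- exact: fat_cut_component.
- exact: open_lift_domain.
- by move=> t q Uq t01; exact: arc_point_in.
- by move=> t q Uq t01; exact: arc_point_int.
- apply: smoothM => //; [exact: fat_cut_component|exact: smooth_length].
Qed.

(** Restriction to the arc over a fixed [q]. *)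
Section Fiber.
Variables (i : 'I_n) (q : 'rV[R]_n).
Hypothesis Uq : lift_domain q.
Let arc : set R^o := `[q 0 i, arc_end q i].
Let at_x (x : R^o) : V := (x, q).

Lemma fat_arc : fat arc.
Proof. by apply: fat_itv; exact: Uq. Qed.

Lemma at_x_affine x h (v : R^o) : at_x (x + h *: v) = at_x x + h *: (v, 0).
Proof. by rewrite /at_x; congr pair; rewrite /= scaler0 addr0. Qed.

Lemma at_x_in x : arc x -> cut_component i (at_x x).
Proof. by rewrite /arc /= in_itv. Qed.

Lemma at_x_cont : continuous at_x.
Proof. by move=> x; exact: (cvg_pair cvg_id (cvg_cst _)). Qed.

Lemma fiber_smooth f : smooth_on (cut_component i) f -> smooth_on arc (f \o at_x).
Proof.
apply: (@smooth_affine _ _ _ arc _ at_x (fun v => (v, 0))); first exact: at_x_affine.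
- exact: at_x_in.
- exact: fat_arc.
- exact: at_x_cont.
Qed.

Lemma fiber_derive f x : smooth_on (cut_component i) f -> arc x ->
  derive_on arc 1 (f \o at_x) x = d_x i f (at_x x).
Proof.
move=> sf ax; rewrite d_x.unlock.
apply: (@derive_on_affine _ _ _ arc (cut_component i) at_x (fun v => (v, 0))) => //.
- exact: at_x_affine.
- exact: fat_arc.
Qed.

Lemma open_arc_derive (U : R -> R) f : smooth_on (cut_component i) f ->
  (forall x, q 0 i < x < arc_end q i -> U x = f (at_x x)) ->
  forall x, q 0 i < x < arc_end q i -> derive_on arc 1 (U : R^o -> R) x = d_x i f (at_x x).
Proof.
move=> sf Uf x x01; have ax : arc x by rewrite /arc /= in_itv /=; case/andP: x01 => ? ?; rewrite !ltW.
rewrite -fiber_derive//.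
apply: (@eq_derive_on _ _ _ [set` `]q 0 i, arc_end q i[]) => //.
- by move=> y _ /=; rewrite in_itv /=; exact: Uf.
Qed.

(** Only the values of [F] and [G] on the open arc matter. *)
Lemma Omega_arc (F G : R -> R) f g :
  smooth_on (cut_component i) f -> smooth_on (cut_component i) g ->
  (forall x, q 0 i < x < arc_end q i -> F x = f (at_x x)) ->
  (forall x, q 0 i < x < arc_end q i -> G x = g (at_x x)) ->
  Rintegral lebesgue_measure arc (fun x =>
    derive_on arc 1 F x * derive_on arc 1 (derive_on arc 1 G) x -
    derive_on arc 1 (derive_on arc 1 F) x * derive_on arc 1 G x) =
  arc_integral i (gf_density i f g) q.
Proof.
move=> sf sg Ff Gg.
have cd : {within `[q 0 i, arc_end q i], continuous (fun x => gf_density i f g (at_x x))}.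
  exact: smooth_continuous (fiber_smooth (smooth_density sf sg)).
transitivity (itv_integral (q 0 i) (arc_end q i) (fun x => gf_density i f g (at_x x))).
  symmetry; apply: eq_integral_oo => // x x01; rewrite /gf_density.
  have dF := open_arc_derive sf Ff; have dG := open_arc_derive sg Gg.
  have ddF := open_arc_derive (smooth_d_x sf) dF; have ddG := open_arc_derive (smooth_d_x sg) dG.
  by rewrite dF// dG// ddF// ddG.
rewrite integral_affine// /arc_integral /par_integral; congr (itv_integral _ _ _).
by apply/funext => t; rewrite /par_integrand arc_point expr0 mul1r.
Qed.

End Fiber.

Section SectionForm.
Variables (i : 'I_n) (u v : family R n).
Hypotheses (su : smooth_section u) (sv : smooth_section v).

Lemma pullback_shift (w : family R n) k (z : V) : k \is a Num.int ->
  pullback w (z + (k, const_mx k)) = pullback w z.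
Proof. by move=> kZ; rewrite /pullback /= to_circleD// to_conf_shift. Qed.

Lemma d_x_shift (f : V -> R) k (z : V) : (forall y, f (y + (k, const_mx k)) = f y) ->
  d_x i f (z + (k, const_mx k)) = d_x i f z.
Proof.
by move=> fc; rewrite d_x.unlock; apply: derive_on_shift => // y; rewrite cut_component_shift.
Qed.

Lemma pullback_lift (w : family R n) p x : B p -> pullback w (x, lift p) = w (to_circle x) p.
Proof. by move=> /liftP[_ E]; rewrite /pullback /= E. Qed.

Lemma arc_integral_shift f k q :
  (forall z, f (z + (k, const_mx k)) = f z) -> arc_integral i f (q + const_mx k) = arc_integral i f q.
Proof.
move=> fc; rewrite /arc_integral /par_integral; congr (itv_integral _ _ _).
apply/funext => t; rewrite /par_integrand !arc_point /length_fun /=.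
have -> : arc_length (q + const_mx k) i = arc_length q i.
  by rewrite /arc_length arc_end_shift !mxE; ring.
congr (_ * (_ * _)); rewrite -(fc (_, q)); congr f; congr pair.
by rewrite !mxE /=; ring.
Qed.

(** [Omega i] on sections does not depend on the chosen lift, by periodicity. *)
Lemma Omega_sections q : lift_domain q ->
  Omega i (to_conf q) (u^~ (to_conf q)) (v^~ (to_conf q)) =
  arc_integral i (gf_density i (pullback u) (pullback v)) q.
Proof.
move=> Uq; set p := to_conf q.
have Bp : B p by exists q.
have [UL EL] := liftP Bp.
rewrite /Omega (Omega_arc UL (su.2 i) (sv.2 i)); try by move=> x _; rewrite pullback_lift.
have [k kZ ->] := lift_to_conf Uq; apply: arc_integral_shift => z.
have us := @pullback_shift u k ^~ kZ; have vs := @pullback_shift v k ^~ kZ.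
by rewrite /gf_density !(d_x_shift _ (fun z => d_x_shift z us))
  !(d_x_shift _ (fun z => d_x_shift z vs)) (d_x_shift _ us) (d_x_shift _ vs).
Qed.

End SectionForm.

End Lifts.

(** * The pointwise cocycle identity *)

(** The derivation [a d/dx + X], where [X] is a constant vector in the base. *)
HB.lock Definition transport (R : realType) (m : nat) (i : 'I_m.+1)
    (a : R^o * 'rV[R]_m.+1 -> R) (X : 'rV[R]_m.+1) (f : R^o * 'rV[R]_m.+1 -> R)
    (z : R^o * 'rV[R]_m.+1) : R :=
  a z * d_x i f z + d_base i X f z.

Section Cocycle.
Context {R : realType} {m : nat}.
Local Notation n := m.+1.
Implicit Types (q : 'rV[R]_n) (k x : R).
Local Notation V := (R^o * 'rV[R]_n)%type.
Variable i : 'I_n.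
Local Notation W := (@cut_component R n i).
Local Notation smooth f := (smooth_on W f).
Local Notation fatW := (@fat_cut_component R m i).
Implicit Types (f g a : V -> R) (X : 'rV[R]_n) (z : V).

Local Notation d_base := (@d_base R m i).

Local Notation transport := (@transport R m i).

Lemma smooth_d_base X f : smooth f -> smooth (d_base X f).
Proof. by rewrite d_base.unlock; exact: smooth_derive_on. Qed.

Lemma smoothB f g : smooth f -> smooth g -> smooth (fun z => f z - g z).
Proof.
move=> sf sg; apply: (@eq_smooth_on _ _ _ (fun z => f z + cst (-1) z * g z)).
  by move=> z _; rewrite /= mulN1r.
apply: smoothD => //; first exact: fatW.
by apply: smoothM => //; [exact: fatW|apply: smooth_cst; exact: fatW].
Qed.

Lemma smooth_transport a X f : smooth a -> smooth f -> smooth (transport a X f).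
Proof.
move=> sa sf; rewrite transport.unlock; apply: smoothD; [exact: fatW| |exact: smooth_d_base].
by apply: smoothM => //; [exact: fatW|exact: smooth_d_x].
Qed.

Lemma d_xM f g z : smooth f -> smooth g -> W z ->
  d_x i (fun y => f y * g y) z = d_x i f z * g z + f z * d_x i g z.
Proof.
move=> sf sg Wz; rewrite ?d_x.unlock ?d_base.unlock.
apply: derive_onE => //; first exact: fatW.
by apply: has_derivM; exact: smooth_has_deriv.
Qed.

Lemma d_xD f g z : smooth f -> smooth g -> W z ->
  d_x i (fun y => f y + g y) z = d_x i f z + d_x i g z.
Proof.
move=> sf sg Wz; rewrite ?d_x.unlock ?d_base.unlock.
apply: derive_onE => //; first exact: fatW.
by apply: has_derivD; exact: smooth_has_deriv.
Qed.

Lemma d_xB f g z : smooth f -> smooth g -> W z ->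
  d_x i (fun y => f y - g y) z = d_x i f z - d_x i g z.
Proof.
move=> sf sg Wz.
have -> : (fun y => f y - g y) = (fun y => f y + cst (-1) y * g y).
  by apply/funext => y; rewrite /= mulN1r.
have sc : smooth (cst (-1 : R) : V -> R) by apply: smooth_cst; exact: fatW.
rewrite d_xD//; last by apply: smoothM => //; exact: fatW.
rewrite d_xM//.
have -> : d_x i (cst (-1) : V -> R) z = 0.
  rewrite ?d_x.unlock ?d_base.unlock.
  by apply: derive_onE => //; [exact: fatW|exact: has_deriv_cst].
by rewrite /=; ring.
Qed.

Lemma d_baseD X f g z : smooth f -> smooth g -> W z ->
  d_base X (fun y => f y + g y) z = d_base X f z + d_base X g z.
Proof.
move=> sf sg Wz; rewrite ?d_x.unlock ?d_base.unlock.
apply: derive_onE => //; first exact: fatW.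
by apply: has_derivD; exact: smooth_has_deriv.
Qed.

Lemma d_baseM X f g z : smooth f -> smooth g -> W z ->
  d_base X (fun y => f y * g y) z = d_base X f z * g z + f z * d_base X g z.
Proof.
move=> sf sg Wz; rewrite ?d_x.unlock ?d_base.unlock.
apply: derive_onE => //; first exact: fatW.
by apply: has_derivM; exact: smooth_has_deriv.
Qed.

Lemma d_baseB X f g z : smooth f -> smooth g -> W z ->
  d_base X (fun y => f y - g y) z = d_base X f z - d_base X g z.
Proof.
move=> sf sg Wz.
have -> : (fun y => f y - g y) = (fun y => f y + cst (-1) y * g y).
  by apply/funext => y; rewrite /= mulN1r.
have sc : smooth (cst (-1 : R) : V -> R) by apply: smooth_cst; exact: fatW.
rewrite d_baseD//; last by apply: smoothM => //; exact: fatW.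
rewrite d_baseM//.
have -> : d_base X (cst (-1) : V -> R) z = 0.
  rewrite ?d_x.unlock ?d_base.unlock.
  by apply: derive_onE => //; [exact: fatW|exact: has_deriv_cst].
by move: (d_base X f z) (d_base X g z) => x y; rewrite /=; ring.
Qed.

Lemma d_x_base X f z : smooth f -> open_cell i z ->
  d_x i (d_base X f) z = d_base X (d_x i f) z.
Proof.
move=> sf Oz; rewrite d_x.unlock d_base.unlock.
by apply: derive_on_comm => //; exact: open_cell_interior.
Qed.

Lemma transportM a X f g z : smooth f -> smooth g -> W z ->
  transport a X (fun y => f y * g y) z = transport a X f z * g z + f z * transport a X g z.
Proof. by move=> sf sg Wz; rewrite transport.unlock d_xM// d_baseM//; ring. Qed.

Lemma transportB a X f g z : smooth f -> smooth g -> W z ->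
  transport a X (fun y => f y - g y) z = transport a X f z - transport a X g z.
Proof. by move=> sf sg Wz; rewrite transport.unlock d_xB// d_baseB//; ring. Qed.

Lemma cell_W z : open_cell i z -> W z.
Proof. by move=> /open_cell_interior/nbhs_singleton. Qed.

Lemma d_x_transport a X f z : smooth a -> smooth f -> open_cell i z ->
  d_x i (transport a X f) z = d_x i a z * d_x i f z + transport a X (d_x i f) z.
Proof.
move=> sa sf Oz; have Wz := cell_W Oz.
rewrite transport.unlock d_xD//; first last.
- exact: smooth_d_base.
- by apply: smoothM; [exact: fatW|exact: sa|exact: smooth_d_x].
rewrite d_xM//; last exact: smooth_d_x.
by rewrite d_x_base// addrA.
Qed.

Lemma eq_d_x f g : (forall z, open_cell i z -> f z = g z) ->
  forall z, open_cell i z -> d_x i f z = d_x i g z.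
Proof.
move=> fg z Oz; rewrite d_x.unlock; apply: (@eq_derive_on _ _ W (open_cell i)) => //.
- exact: open_open_cell.
- exact: cell_W.
- by move=> y _ Oy; exact: fg.
Qed.

(** The bracket of two broken fields [a] and [b] moving the breaks with
    velocities [X] and [Y]. *)
Definition bracket_fun a X b Y z := transport a X b z - transport b Y a z.

Lemma smooth_bracket_fun a X b Y : smooth a -> smooth b -> smooth (bracket_fun a X b Y).
Proof. by move=> sa sb; apply: smoothB; exact: smooth_transport. Qed.

Lemma d_x_bracket a X b Y z : smooth a -> smooth b -> open_cell i z ->
  d_x i (bracket_fun a X b Y) z = transport a X (d_x i b) z - transport b Y (d_x i a) z.
Proof.
move=> sa sb Oz; have Wz := cell_W Oz.
rewrite /bracket_fun d_xB//; try exact: smooth_transport.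
by rewrite !d_x_transport//; ring.
Qed.

Lemma d_xx_bracket a X b Y z : smooth a -> smooth b -> open_cell i z ->
  d_x i (d_x i (bracket_fun a X b Y)) z =
  d_x i a z * d_x i (d_x i b) z - d_x i b z * d_x i (d_x i a) z +
  transport a X (d_x i (d_x i b)) z - transport b Y (d_x i (d_x i a)) z.
Proof.
move=> sa sb Oz; have Wz := cell_W Oz.
rewrite (eq_d_x (g := fun z => transport a X (d_x i b) z - transport b Y (d_x i a) z))//; last first.
  by move=> y Oy; exact: d_x_bracket.
have [sda sdb] := (smooth_d_x sa, smooth_d_x sb).
rewrite d_xB//; try exact: smooth_transport.
by rewrite !d_x_transport//; ring.
Qed.

(** The density of the term [L_u (Omega (v, w)) - Omega ([u, v], w)] of the
    cocycle condition; the first summand accounts for the motion of the arc. *)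
Definition cocycle_density a X b Y c z :=
  d_x i a z * gf_density i b c z + transport a X (gf_density i b c) z -
  gf_density i (bracket_fun a X b Y) c z.

Lemma smooth_cocycle_density a X b Y c : smooth a -> smooth b -> smooth c ->
  smooth (cocycle_density a X b Y c).
Proof.
move=> sa sb sc; have sbc := smooth_density sb sc.
apply: (@smoothB (fun z => d_x i a z * gf_density i b c z + transport a X (gf_density i b c) z));
  last by apply: smooth_density => //; exact: smooth_bracket_fun.
apply: smoothD; [exact: fatW| |exact: smooth_transport].
by apply: smoothM; [exact: fatW|exact: smooth_d_x|].
Qed.

(** Here the derivatives of [b] and [c] along [a d/dx + X] partly cancel; in the
    cyclic sum the remaining ones cancel in pairs. *)
Lemma cocycle_densityE a X b Y c z : smooth a -> smooth b -> smooth c -> open_cell i z ->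
  cocycle_density a X b Y c z =
  d_x i b z * transport a X (d_x i (d_x i c)) z - d_x i (d_x i b) z * transport a X (d_x i c) z +
  transport b Y (d_x i a) z * d_x i (d_x i c) z - transport b Y (d_x i (d_x i a)) z * d_x i c z +
  d_x i a z * d_x i b z * d_x i (d_x i c) z - d_x i b z * d_x i (d_x i a) z * d_x i c z.
Proof.
move=> sa sb sc Oz; have Wz := cell_W Oz.
have [db dc] := (smooth_d_x sb, smooth_d_x sc).
have [ddb ddc] := (smooth_d_x db, smooth_d_x dc).
rewrite /cocycle_density {2}/gf_density transportB//;
  try by apply: smoothM => //; exact: fatW.
rewrite !transportM// /gf_density d_x_bracket// d_xx_bracket//.
by ring.
Qed.

Lemma cocycle_density_sum a X b Y c Z z : smooth a -> smooth b -> smooth c -> open_cell i z ->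
  cocycle_density a X b Y c z + cocycle_density b Y c Z a z + cocycle_density c Z a X b z = 0.
Proof. by move=> sa sb sc Oz; rewrite !cocycle_densityE//; ring. Qed.

(** Linearity of the integral over the arc. *)
Lemma arc_integrand_continuous f q : smooth f -> lift_domain q ->
  {within `[0, 1], continuous
    (fun t => par_integrand (base_pt i) (arc_dir i) 0 (fun z => length_fun i z * f z) t q)}.
Proof.
move=> sf Uq.
apply: (@par_integrand_continuous _ _ _ W (@lift_domain R n)) => //.
- exact: base_pt_cont.
- exact: arc_dir_cont.
- by move=> t y Uy t01; exact: arc_point_in.
- by apply: smoothM => //; [exact: fatW|exact: smooth_length].
Qed.

Lemma arc_integralD f g q : smooth f -> smooth g -> lift_domain q ->
  arc_integral i (fun z => f z + g z) q = arc_integral i f q + arc_integral i g q.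
Proof.
move=> sf sg Uq; rewrite /arc_integral /par_integral -itv_integralD;
  try exact: arc_integrand_continuous.
by congr (itv_integral _ _ _); apply/funext => t; rewrite /par_integrand; ring.
Qed.

Lemma arc_integralB f g q : smooth f -> smooth g -> lift_domain q ->
  arc_integral i (fun z => f z - g z) q = arc_integral i f q - arc_integral i g q.
Proof.
move=> sf sg Uq; rewrite /arc_integral /par_integral -itv_integralB;
  try exact: arc_integrand_continuous.
by congr (itv_integral _ _ _); apply/funext => t; rewrite /par_integrand; ring.
Qed.

Lemma eq_arc_integral f g q : smooth f -> lift_domain q ->
  (forall z, open_cell i z -> f z = g z) -> arc_integral i f q = arc_integral i g q.
Proof.
move=> sf Uq fg; apply: eq_integral_oo; first exact: arc_integrand_continuous.
by move=> t t01; rewrite /par_integrand fg//; exact: arc_point_cell.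
Qed.

Lemma arc_integral0 q : arc_integral i (fun _ => 0) q = 0.
Proof.
rewrite /arc_integral /par_integral (_ : (fun t => _) = cst 0).
  by rewrite /itv_integral Rintegral_cst//= mul0r.
by apply/funext => t; rewrite /par_integrand mulr0 mulr0.
Qed.

End Cocycle.

(** * Closedness of the form *)

Lemma is_derive_within01 (R : realType) (g : R -> R) (t l : R) : 0 < t < 1 ->
  @has_deriv R R^o [set` `[(0 : R), 1]] 1 g t l -> is_derive t 1 g l.
Proof.
move=> t01; rewrite has_deriv_nbhs; last first.
  apply: (@filterS _ (nbhs t) _ [set` `]0, 1[]); last by apply: near_in_itvoo; rewrite in_itv.
  by move=> s /=; rewrite !in_itv /= => /andP[? ?]; rewrite !ltW.
have -> : diff_quot (g : R^o -> R) 1 t = (fun h : R => h^-1 *: ((g \o shift t) (h *: 1) - g t)).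
  by apply/funext => h; rewrite /diff_quot /= [t + _]addrC.
move=> H; split; first by apply/cvg_ex; exists l.
exact: cvg_lim H.
Qed.

Lemma derive_has_deriv (R : realType) (V : normedModType R) (W : set V) v (f : V -> R) z l :
  nbhs z W -> has_deriv W v f z l -> 'D_v f z = l.
Proof.
move=> Wz; rewrite has_deriv_nbhs// => H; rewrite /derive.
have -> : (fun h : R => h^-1 *: ((f \o shift z) (h *: v) - f z)) = diff_quot f v z.
  by apply/funext => h; rewrite /diff_quot /= [z + _]addrC.
exact: cvg_lim H.
Qed.

Lemma right_derive_int (R : realType) (V : normedModType R) (W : set V) v (f : V -> R) z :
  smooth_on W f -> nbhs z W -> right_derive v f z = derive_on W v f z.
Proof.
move=> sf Wz; have := smooth_has_deriv (v := v) sf (nbhs_singleton Wz).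
by rewrite has_deriv_nbhs// => /cvg_dnbhs_at_right H; exact: cvg_lim H.
Qed.

Lemma left_derive_int (R : realType) (V : normedModType R) (W : set V) v (f : V -> R) z :
  smooth_on W f -> nbhs z W -> left_derive v f z = derive_on W v f z.
Proof.
move=> sf Wz; have := smooth_has_deriv (v := v) sf (nbhs_singleton Wz).
by rewrite has_deriv_nbhs// => /cvg_dnbhs_at_left H; exact: cvg_lim H.
Qed.

Section LieDerivative.
Context {R : realType} {m : nat}.
Local Notation n := m.+1.
Implicit Types (q : 'rV[R]_n) (k x : R).
Local Notation V := (R^o * 'rV[R]_n)%type.
Variable i : 'I_n.
Local Notation W := (@cut_component R n i).
Local Notation smooth f := (smooth_on W f).
Local Notation fatW := (@fat_cut_component R m i).
Implicit Types (f g a : V -> R) (X : 'rV[R]_n) (z : V).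

Lemma derive_dirE f z (c : R) X : smooth f -> open_cell i z ->
  derive_on W ((c, X) : V) f z = c * d_x i f z + d_base i X f z.
Proof.
move=> sf Oz; have nW := open_cell_interior Oz; have Wz := nbhs_singleton nW.
have -> : ((c, X) : V) = c *: ((1, 0) : V) + (0, X).
  by congr pair; rewrite /= ?scaler0 ?add0r// addr0 [RHS]mulr1.
rewrite derive_onD//; last exact: fatW.
by rewrite derive_onZ//; [rewrite d_x.unlock d_base.unlock|exact: fatW].
Qed.

Lemma d_base_sum f z X : smooth f -> open_cell i z ->
  d_base i X f z = \sum_j X 0 j * d_base i (delta_mx 0 j) f z.
Proof.
move=> sf Oz; have nW := open_cell_interior Oz; have Wz := nbhs_singleton nW.
have dZ (c : R) Y : d_base i (c *: Y) f z = c * d_base i Y f z.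
  have E : ((0, c *: Y) : V) = c *: ((0, Y) : V) by congr pair; rewrite /= [RHS]mulr0.
  by rewrite d_base.unlock E derive_onZ//; exact: fatW.
have dD Y Z : d_base i (Y + Z) f z = d_base i Y f z + d_base i Z f z.
  have E : ((0, Y + Z) : V) = (0, Y) + (0, Z) by congr pair; rewrite /= addr0.
  by rewrite d_base.unlock E derive_onD//; exact: fatW.
have d0 : d_base i 0 f z = 0 by have := dZ 0 0; rewrite scale0r mul0r.
rewrite {1}(row_sum_delta X).
rewrite (big_morph (fun Y => d_base i Y f z) dD d0).
by apply: eq_bigr => j _; rewrite dZ.
Qed.

Lemma arc_has_deriv g q (t : R) : smooth g -> lift_domain q -> 0 <= t <= 1 ->
  @has_deriv R R^o [set` `[(0 : R), 1]] 1
    (fun t => g (segment_point (base_pt i) (arc_dir i) t q)) t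
    (arc_length q i * d_x i g (segment_point (base_pt i) (arc_dir i) t q)).
Proof.
move=> sg Uq t01.
have Wp := arc_point_in i Uq t01.
have -> : arc_length q i * d_x i g (segment_point (base_pt i) (arc_dir i) t q) =
    derive_on W (1 *: arc_dir i q) g (segment_point (base_pt i) (arc_dir i) t q).
  have E : arc_dir i q = arc_length q i *: ((1, 0) : V).
    by congr pair; rewrite /= ?scaler0// [RHS]mulr1.
  by rewrite scale1r E d_x.unlock derive_onZ//; exact: fatW.
apply: (@has_deriv_affine _ R^o _ _ W (fun t => segment_point (base_pt i) (arc_dir i) t q)
   (fun s => s *: arc_dir i q)).
- by move=> s h w; rewrite /segment_point scalerDl scalerA addrA.
- by move=> s /=; rewrite in_itv; exact: arc_point_in.
- exact: smooth_has_deriv.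
Qed.

(** The derivative of an integral over the moving arc: the boundary terms are
    turned into the integral of [d/dx (a f)], as [a] agrees at both ends with
    the velocities of the end points. *)
Lemma has_deriv_arc_integral a X f q : smooth a -> smooth f -> lift_domain q ->
  a (q 0 i, q) = X 0 i -> a (arc_end q i, q) = X 0 (ordS i) ->
  has_deriv (@lift_domain R n) X (arc_integral i f) q
    (arc_integral i (fun z => d_x i a z * f z + transport i a X f z) q).
Proof.
move=> sa sf Uq a0 a1.
pose F z := length_fun i z * f z.
have sF : smooth F by apply: smoothM => //; [exact: fatW|exact: smooth_length].
have := @has_deriv_par_integral _ _ _ W (@lift_domain R n) (base_pt i) (arc_dir i)
  (base_pt i) (arc_dir0 i) (@base_pt_affine R m i) (@arc_dir_affine R m i)
  (@base_pt_cont R m i) (@arc_dir_cont R m i) fatW (@open_lift_domain R m)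
  (fun t q Uq t01 => @arc_point_in R m i t q Uq t01)
  (fun t q Uq t01 => @arc_point_int R m i t q Uq t01) 0 F q X sF Uq.
suff -> : par_integral (base_pt i) (arc_dir i) 0 (derive_on W (base_pt i X) F) q +
   par_integral (base_pt i) (arc_dir i) 1 (derive_on W (arc_dir0 i X) F) q =
   arc_integral i (fun z => d_x i a z * f z + transport i a X f z) q by [].
pose G z := d_x i a z * f z + transport i a X f z.
have sG : smooth G.
  apply: smoothD; [exact: fatW| |exact: smooth_transport].
  by apply: smoothM; [exact: fatW|exact: smooth_d_x|].
have cpar (k : nat) g : smooth g -> {within `[0, 1], continuous
    (fun t => par_integrand (base_pt i) (arc_dir i) k g t q)}.
  move=> sg; apply: (@par_integrand_continuous _ _ _ W (@lift_domain R n)) => //.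
  - exact: base_pt_cont.
  - exact: arc_dir_cont.
  - by move=> t y Uy t01; exact: arc_point_in.
have cA := cpar 0%N _ (smooth_derive_on (base_pt i X) sF).
have cB := cpar 1%N _ (smooth_derive_on (arc_dir0 i X) sF).
have cG := @arc_integrand_continuous R m i G q sG Uq.
rewrite /arc_integral -/G /par_integral -itv_integralD//.
apply/eqP; rewrite -subr_eq0 -itv_integralB//; last first.
  by move=> t; apply: cvgD; [exact: cA|exact: cB].
pose d := X 0 (ordS i) - X 0 i.
pose phi t := segment_point (base_pt i) (arc_dir i) t q.
(* The difference of the two integrands is the derivative of [H], where
   [X 0 i + t * d] is the velocity of the point at time [t] of the arc; [H]
   vanishes at both ends. *)
pose H t := (X 0 i + t * d - a (phi t)) * f (phi t).
have dH (t : R) : 0 <= t <= 1 -> @has_deriv R R^o [set` `[(0 : R), 1]] 1 H t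
    ((d - arc_length q i * d_x i a (phi t)) * f (phi t) +
     (X 0 i + t * d - a (phi t)) * (arc_length q i * d_x i f (phi t))).
  move=> t01; apply: has_derivM; last exact: arc_has_deriv.
  have -> : d - arc_length q i * d_x i a (phi t) =
      (0 + (1 * d + t * 0)) + (0 * a (phi t) + (-1) * (arc_length q i * d_x i a (phi t))) by ring.
  have -> : (fun y : R^o => X 0 i + y * d - a (phi y)) =
    (fun y : R^o => (cst (X 0 i) y + id y * cst d y) + cst (-1) y * a (phi y)).
    by apply/funext => y /=; rewrite mulN1r.
  apply: has_derivD; last by apply: has_derivM; [exact: has_deriv_cst|exact: arc_has_deriv].
  apply: has_derivD; first exact: has_deriv_cst.
  apply: has_derivM; last exact: has_deriv_cst.
  rewrite /has_deriv; apply: (@cvg_trans _ (cst (1 : R) @ @within_step R R^o [set` `[(0 : R), 1]] 1 t)); last exact: cvg_cst.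
  apply: near_eq_cvg; near=> h.
  have h0 : h != 0 by near: h; exact: within_step_neq0.
  by rewrite /diff_quot addrC addrA addNr add0r /GRing.scale/= mulr1 mulVf.
have cH : {within `[0, 1], continuous H}.
  have -> : H = (fun t => (X 0 i + t * d) * f (phi t) - a (phi t) * f (phi t)).
    by apply/funext => t; rewrite /H; ring.
  have cphi g : smooth g -> {within `[0, 1], continuous (fun t => g (phi t))}.
    move=> sg; apply: (@eq_within_continuous R R^o _ _ _ _ (cpar 0%N _ sg)) => t _.
    by rewrite /par_integrand expr0 mul1r.
  have cl : continuous (fun t : R => X 0 i + t * d).
    move=> t; apply: cvgD; first exact: cvg_cst.
    by apply: cvgM; [exact: cvg_id|exact: cvg_cst].
  move=> t; apply: cvgB; apply: cvgM; try exact: cphi.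
  exact: (continuous_subspaceT cl).
have H01 : H 1 - H 0 = 0.
  have p0 : phi 0 = (q 0 i, q) by rewrite /phi arc_point mul0r addr0.
  have p1 : phi 1 = (arc_end q i, q).
    by rewrite /phi arc_point mul1r /arc_length addrC subrK.
  by rewrite /H p0 p1 a0 a1 /d; ring.
apply/eqP; rewrite -[RHS]H01; apply: (@integral_FTC _ 0 1 _ H).
- exact: ltr01.
- by move=> t; apply: cvgB; [apply: cvgD; [exact: cA|exact: cB]|exact: cG].
- exact: cH.
- move=> t t01; have t01' : 0 <= t <= 1 by case/andP: t01 => ? ?; rewrite !ltW.
  apply: is_derive_within01 => //.
  have Op := arc_point_cell i Uq t01; have Wp := arc_point_in i Uq t01'.
  have dF v : derive_on W v F (phi t) =
     (v.2 0 (ordS i) - v.2 0 i) * f (phi t) + arc_length q i * derive_on W v f (phi t).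
    apply: derive_onE => //; first exact: fatW.
    have -> : arc_length q i = length_fun i (phi t) by rewrite /phi arc_point.
    by apply: has_derivM; [exact: has_deriv_length|exact: smooth_has_deriv].
  have := dH t t01'; congr has_deriv.
  rewrite /par_integrand -/(phi t) !dF /G transport.unlock /= !mxE expr0 expr1.
  rewrite [base_pt i X]/base_pt [arc_dir0 i X]/arc_dir0 !derive_dirE//.
  have -> : d_base i 0 f (phi t) = 0.
    rewrite d_base.unlock.
    have -> : ((0, 0) : V) = 0 *: ((0, 0) : V) by rewrite scale0r.
    by rewrite derive_onZ ?mul0r//; exact: fatW.
  have -> : length_fun i (phi t) = arc_length q i by rewrite /phi arc_point.
  by rewrite /d; ring.
Unshelve. all: by end_near. Qed.

End LieDerivative.

Section SectionCocycle.
Context {R : realType} {m : nat}.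
Local Notation n := m.+1.
Local Notation V := (R^o * 'rV[R]_n)%type.
Variable i : 'I_n.
Local Notation W := (@cut_component R n i).
Local Notation smooth f := (smooth_on W f).
Implicit Types (u v w : family R n) (p : conf R n).

Lemma repr_to_circle (x : R) : exists2 k, k \is a Num.int & repr (to_circle x) = x + k.
Proof.
have /to_circleP xZ : to_circle (repr (to_circle x)) = to_circle x.
  by rewrite /to_circle reprK.
by exists (repr (to_circle x) - x); rewrite // addrC subrK.
Qed.

Lemma pullback_shift_x w (x k : R) (q : 'rV[R]_n) : k \is a Num.int ->
  pullback w ((x + k, q) : V) = pullback w (x, q).
Proof. by move=> kZ; rewrite /pullback /= to_circleD. Qed.

Lemma diff_quot_shift_x w (v : V) (x k : R) (q : 'rV[R]_n) : k \is a Num.int ->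
  diff_quot (pullback w) v ((x + k, q) : V) = diff_quot (pullback w) v (x, q).
Proof.
move=> kZ; apply/funext => h; rewrite /diff_quot pullback_shift_x//.
congr (_ * (_ - _)).
have -> : ((x + k, q) : V) + h *: v = ((x + (h *: v).1) + k, q + (h *: v).2).
  by congr pair; rewrite /= addrAC.
exact: pullback_shift_x.
Qed.

Lemma to_circle_arc_end (q : 'rV[R]_n) : to_circle (arc_end q i) = to_circle (q 0 (ordS i)).
Proof. by rewrite /arc_end; case: (i.+1 == n); rewrite /= ?addr0// to_circleD. Qed.

Section AtPoint.
Variable p : conf R n.
Hypothesis Bp : B p.
Let q := lift p.
Let Uq : lift_domain q := (liftP Bp).1.
Let qp : to_conf q = p := (liftP Bp).2.

Lemma pullback_break u j : pullback u ((q 0 j : R, q) : V) = u (p j) p.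
Proof. by rewrite /pullback /= qp; congr u; rewrite -[in RHS]qp. Qed.

Lemma pullback_anchor u : pullback u ((q 0 i, q) : V) = (anchor u p) 0 i.
Proof. by rewrite mxE pullback_break. Qed.

Lemma pullback_anchor_end u : pullback u ((arc_end q i, q) : V) = (anchor u p) 0 (ordS i).
Proof. by rewrite mxE -pullback_break /pullback /= to_circle_arc_end. Qed.

Lemma dx_cell u x : smooth_section u -> q 0 i < x < arc_end q i ->
  dx u (to_circle x) p = d_x i (pullback u) (x, q).
Proof.
move=> su x01; have [k kZ E] := repr_to_circle x.
rewrite /dx /right_derive E diff_quot_shift_x// d_x.unlock.
have Oz : open_cell i ((x, q) : V) by [].
exact: right_derive_int (su.2 i) (open_cell_interior Oz).
Qed.

Lemma dp_cell u j x : smooth_section u -> q 0 i < x < arc_end q i ->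
  dp j u (to_circle x) p = d_base i (delta_mx 0 j) (pullback u) (x, q).
Proof.
move=> su x01; have [k kZ E] := repr_to_circle x.
rewrite /dp /left_derive E diff_quot_shift_x// d_base.unlock.
have Oz : open_cell i ((x, q) : V) by [].
exact: left_derive_int (su.2 i) (open_cell_interior Oz).
Qed.

(** On the open arc all one-sided derivatives in the bracket are ordinary
    partial derivatives. *)
Lemma bracket_cell u v x : smooth_section u -> smooth_section v ->
  q 0 i < x < arc_end q i ->
  bracket u v (to_circle x) p =
  bracket_fun i (pullback u) (anchor u p) (pullback v) (anchor v p) (x, q).
Proof.
move=> su sv x01; have Oz : open_cell i ((x, q) : V) by [].
rewrite /bracket !dx_cell// /bracket_fun transport.unlock.
rewrite (d_base_sum _ (su.2 i) Oz) (d_base_sum _ (sv.2 i) Oz) -!(pullback_lift _ _ Bp) -/q.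
under eq_bigr do rewrite !dp_cell//.
rewrite sumrB.
have -> : \sum_j anchor u p 0 j * d_base i (delta_mx 0 j) (pullback v) (x, q) =
  \sum_j u (p j) p * d_base i (delta_mx 0 j) (pullback v) (x, q).
  by apply: eq_bigr => j _; rewrite mxE.
have -> : \sum_j anchor v p 0 j * d_base i (delta_mx 0 j) (pullback u) (x, q) =
  \sum_j v (p j) p * d_base i (delta_mx 0 j) (pullback u) (x, q).
  by apply: eq_bigr => j _; rewrite mxE.
by ring.
Qed.

Lemma Lie_derive_Omega u v w : smooth_section u -> smooth_section v -> smooth_section w ->
  Lie_derive (anchor u) (fun p' => Omega i p' (v^~ p') (w^~ p')) p =
  arc_integral i (fun z => d_x i (pullback u) z * gf_density i (pullback v) (pullback w) z +
    transport i (pullback u) (anchor u p) (gf_density i (pullback v) (pullback w)) z) q.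
Proof.
move=> su sv sw; rewrite /Lie_derive -/q.
have nU : nbhs q (@lift_domain R n) by apply: open_nbhs_nbhs; split => //; exact: open_lift_domain.
apply: (@derive_has_deriv _ _ (@lift_domain R n)) => //.
apply: (@eq_has_deriv _ _ _ setT _ (arc_integral i (gf_density i (pullback v) (pullback w)))) => //.
- exact: openT.
- by move=> y Uy _; rewrite /= Omega_sections.
apply: has_deriv_arc_integral => //.
- exact: (su.2 i).
- by apply: smooth_density; [exact: (sv.2 i)|exact: (sw.2 i)].
- exact: pullback_anchor.
- exact: pullback_anchor_end.
Qed.

Lemma cocycle_termE u v w : smooth_section u -> smooth_section v -> smooth_section w ->
  cocycle_term (@Omega R n i) u v w p =
  arc_integral i (cocycle_density i (pullback u) (anchor u p) (pullback v) (anchor v p) (pullback w)) q.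
Proof.
move=> su sv sw; rewrite /cocycle_term Lie_derive_Omega//.
have [fu [fv fw]] := (su.2 i, (sv.2 i, sw.2 i)).
have fb := smooth_bracket_fun (anchor u p) (anchor v p) fu fv.
rewrite /Omega (Omega_arc Uq fb fw).
- rewrite -arc_integralB//; last exact: smooth_density.
  apply: smoothD; [exact: fat_cut_component| |].
    by apply: smoothM; [exact: fat_cut_component|exact: smooth_d_x|exact: smooth_density].
  by apply: smooth_transport => //; exact: smooth_density.
- by move=> x x01; exact: bracket_cell.
- by move=> x _; rewrite pullback_lift.
Qed.

End AtPoint.

Lemma Omega_cocycle : is_cocycle (@Omega R n i).
Proof.
move=> u v w su sv sw p Bp; rewrite !cocycle_termE//.
have [fu [fv fw]] := (su.2 i, (sv.2 i, sw.2 i)).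
have Uq := (liftP Bp).1.
have s1 := smooth_cocycle_density (anchor u p) (anchor v p) fu fv fw.
have s2 := smooth_cocycle_density (anchor v p) (anchor w p) fv fw fu.
have s3 := smooth_cocycle_density (anchor w p) (anchor u p) fw fu fv.
have s12 := smoothD (@fat_cut_component R m i) s1 s2.
have s123 := smoothD (@fat_cut_component R m i) s12 s3.
rewrite -arc_integralD// -arc_integralD//.
rewrite (@eq_arc_integral _ _ _ _ (fun=> 0) _ s123 Uq); first exact: arc_integral0.
by move=> z Oz; exact: cocycle_density_sum.
Qed.

(** On a single fiber, [Omega i] is bilinear and skew-symmetric. *)
Section FiberForm.
Variable p : conf R n.
Hypothesis Bp : B p.
Let q := lift p.
Let Uq : lift_domain q := (liftP Bp).1.
Let arc : set R^o := lifted_arc p i.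
Let D (f : R^o -> R) := derive_on arc 1 f.

Let fA : fat arc := fat_arc Uq.

Lemma derive_arc_lin (c : R) (f g : R^o -> R) x : smooth_on arc f -> smooth_on arc g -> arc x ->
  D (fun y => c * f y + g y) x = c * D f x + D g x.
Proof.
move=> sf sg ax; apply: derive_onE => //.
have := has_derivD (has_derivM (has_deriv_cst arc 1 c x) (smooth_has_deriv (v := (1 : R^o)) sf ax))
  (smooth_has_deriv (v := (1 : R^o)) sg ax).
by rewrite mul0r add0r.
Qed.

Lemma derive2_arc_lin (c : R) (f g : R^o -> R) x : smooth_on arc f -> smooth_on arc g -> arc x ->
  D (D (fun y => c * f y + g y)) x = c * D (D f) x + D (D g) x.
Proof.
move=> sf sg ax.
rewrite -derive_arc_lin//; try exact: smooth_derive_on.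
apply: (@eq_derive_on _ _ _ setT) => //; first exact: openT.
by move=> y ay _; exact: derive_arc_lin.
Qed.

Let dens (f g : R^o -> R) x := D f x * D (D g) x - D (D f) x * D g x.

Lemma fiber_density_cont f g : smooth_on arc f -> smooth_on arc g ->
  {within arc, continuous (dens f g)}.
Proof.
move=> sf sg; have [df dg] := (smooth_derive_on (1 : R^o) sf, smooth_derive_on (1 : R^o) sg).
have [ddf ddg] := (smooth_derive_on (1 : R^o) df, smooth_derive_on (1 : R^o) dg).
have [c1 c2] := (smooth_continuous df, smooth_continuous dg).
have [c3 c4] := (smooth_continuous ddf, smooth_continuous ddg).
by move=> x; exact: (cvgB (cvgM (@c1 x) (@c4 x)) (cvgM (@c3 x) (@c2 x))).
Qed.

Lemma Omega_fiberE (u v : circle R -> R) :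
  Omega i p u v = itv_integral (q 0 i) (arc_end q i) (dens (u \o @to_circle R) (v \o @to_circle R)).
Proof. by []. Qed.

Lemma Omega_linl (c : R) (u v w : circle R -> R) : BVect p u -> BVect p v -> BVect p w ->
  Omega i p (fun x => c * u x + v x) w = c * Omega i p u w + Omega i p v w.
Proof.
move=> [_ /(_ i) su] [_ /(_ i) sv] [_ /(_ i) sw].
rewrite !Omega_fiberE -itv_integralZ; last exact: fiber_density_cont.
rewrite -itv_integralD; last exact: fiber_density_cont.
  apply: eq_Rintegral => x /set_mem ax.
  by rewrite /dens (derive_arc_lin c su sv ax) (derive2_arc_lin c su sv ax); ring.
by move=> x; apply: cvgM; [exact: cvg_cst|exact: fiber_density_cont].
Qed.

Lemma Omega_skew (u v : circle R -> R) : BVect p u -> BVect p v -> Omega i p u v = - Omega i p v u.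
Proof.
move=> [_ /(_ i) su] [_ /(_ i) sv].
rewrite !Omega_fiberE -mulN1r -itv_integralZ; last exact: fiber_density_cont.
by apply: eq_Rintegral => x _; rewrite /dens; ring.
Qed.

End FiberForm.

Lemma BVect_lin p (c : R) (u v : circle R -> R) : B p -> BVect p u -> BVect p v -> BVect p (fun x => c * u x + v x).
Proof.
move=> Bp [cu su] [cv sv]; split.
  by move=> x; apply: cvgD; [apply: cvgM; [exact: cvg_cst|exact: cu]|exact: cv].
move=> j; have fA := fat_arc (i := j) (liftP Bp).1.
apply: (smoothD fA) (sv j); apply: (smoothM fA) (su j); exact: smooth_cst.
Qed.

Lemma Omega_form2 : is_form2 (@Omega R n i).
Proof.
split.
- by move=> p Bp c u v w; exact: Omega_linl.
- move=> p Bp c u v w bu bv bw.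
  have bvw := BVect_lin c Bp bv bw.
  rewrite (Omega_skew bu bvw) Omega_linl// (Omega_skew bv bu) (Omega_skew bw bu).
  by move: (Omega i p u v) (Omega i p u w) => y z; ring.
- by move=> p Bp u v; exact: Omega_skew.
- move=> u v su sv.
  have := smooth_arc_integral (smooth_density (su.2 i) (sv.2 i)).
  apply: eq_smooth_on => q /set_mem Uq; by rewrite /= Omega_sections.
Qed.

End SectionCocycle.

(** * Nontriviality *)

Section Bump.
Context {R : realType}.
Implicit Types (x y l k : R).

(** The fractional part. *)
Definition frac y : R := y - (Num.floor y)%:~R.

Lemma frac_bounds y : 0 <= frac y < 1.
Proof.
have /andP[y0 y1] := floor_itv y; rewrite intrD in y1.
by rewrite /frac subr_ge0 y0 ltrBlDl.
Qed.

Lemma frac_def y k : k \is a Num.int -> 0 <= y - k < 1 -> frac y = y - k.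
Proof.
move=> kZ yk; apply/eqP; rewrite -subr_eq0; apply/eqP/int_lt1_eq0.
  rewrite /frac (_ : y - _ - (y - k) = k - (Num.floor y)%:~R); last by ring.
  by rewrite rpredB//; apply/intrP; exists (Num.floor y).
by have := frac_bounds y; move: yk => /andP[? ?] /andP[? ?]; rewrite ltr_norml; lra.
Qed.

Lemma fracD y k : k \is a Num.int -> frac (y + k) = frac y.
Proof.
move=> kZ; rewrite (@frac_def (y + k) (k + (Num.floor y)%:~R)).
- by rewrite /frac; ring.
- by rewrite rpredD//; apply/intrP; exists (Num.floor y).
- by have := frac_bounds y; rewrite /frac => ?; lra.
Qed.

Variables a b : nat.

(** The monomial [y^a (l - y)^b] on [0, l), continued by zero. *)
Definition bump y l : R := if y < l then y ^+ a * (l - y) ^+ b else 0.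

(** [y^a (l - y)^b] on [0, l], continued by zero to the line; unlike [bump], it
    is visibly continuous. *)
Definition clamp_mono y l : R :=
  Num.max 0 (Num.min y l) ^+ a * (l - Num.max 0 (Num.min y l)) ^+ b.

Hypotheses (a0 : (0 < a)%N) (b0 : (0 < b)%N).

Lemma bump0 l : bump 0 l = 0.
Proof. by rewrite /bump expr0n gtn_eqF// mul0r if_same. Qed.

Lemma bumpE y l : 0 <= y <= l -> bump y l = y ^+ a * (l - y) ^+ b.
Proof.
rewrite /bump => /andP[_]; rewrite le_eqVlt => /predU1P[->|->//].
by rewrite ltxx subrr expr0n gtn_eqF// mulr0.
Qed.

Lemma bump_frac_arc y l : l <= 1 -> 0 <= y <= l -> bump (frac y) l = y ^+ a * (l - y) ^+ b.
Proof.
move=> l1 yl; have [y1|y1] := ltP y 1.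
  by rewrite (@frac_def y 0) ?subr0 ?bumpE//; case/andP: yl => ->.
have [y1' l1'] : y = 1 /\ l = 1 by split; lra.
rewrite (@frac_def y 1)//; last by rewrite y1'; lra.
by rewrite y1' l1' subrr bump0 expr0n gtn_eqF// mulr0.
Qed.

(** If [y] is congruent to a point of [l, 1] then its fractional part is beyond
    [l], or it is zero. *)
Lemma bump_frac_out y l k : k \is a Num.int -> 0 < l -> l <= y - k <= 1 -> bump (frac y) l = 0.
Proof.
move=> kZ l0 yk; have [y1|y1] := ltP (y - k) 1.
  rewrite (@frac_def y k)//; last lra.
  by rewrite /bump ltNge; case/andP: yk => ->.
have kZ1 : k + 1 \is a Num.int by rewrite rpredD// rpred1.
by rewrite (@frac_def y (k + 1))//; [rewrite (_ : y - (k + 1) = 0) ?bump0//; lra|lra].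
Qed.

Lemma clamp_mono_in y l : 0 <= y <= l -> clamp_mono y l = y ^+ a * (l - y) ^+ b.
Proof. by move=> /andP[y0 yl]; rewrite /clamp_mono min_l// max_r. Qed.

Lemma clamp_mono_ge y l : 0 <= l -> l <= y -> clamp_mono y l = 0.
Proof.
by move=> l0 ly; rewrite /clamp_mono min_r// max_r// subrr [0 ^+ b]expr0n gtn_eqF// mulr0.
Qed.

Lemma clamp_mono_le y l : 0 <= l -> y <= 0 -> clamp_mono y l = 0.
Proof.
move=> l0 y0; rewrite /clamp_mono max_l ?expr0n ?gtn_eqF ?mul0r//.
by rewrite ge_min y0.
Qed.

(** Near any point, the periodic continuation is a sum of two clamped monomials. *)
Lemma bump_frac_clamp y l k : k \is a Num.int -> 0 < l <= 1 -> -1 < y - k < 1 ->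
  bump (frac y) l = clamp_mono (y - k) l + clamp_mono (y - k + 1) l.
Proof.
move=> kZ /andP[l0 l1] /andP[y1 y2].
have [y0|y0] := leP 0 (y - k).
  have e : clamp_mono (y - k + 1) l = 0 by apply: clamp_mono_ge; lra.
  rewrite (@frac_def y k) ?y0// e addr0.
  have [yl|yl] := ltP (y - k) l; first by rewrite bumpE ?clamp_mono_in ?y0 ?ltW.
  by rewrite clamp_mono_ge// ?ltW// /bump ltNge yl.
rewrite (clamp_mono_le (ltW l0) (ltW y0)) add0r.
have kZ1 : k - 1 \is a Num.int by rewrite rpredB// rpred1.
rewrite (@frac_def y (k - 1))//; last lra.
rewrite (_ : y - (k - 1) = y - k + 1); last by ring.
have yp : 0 <= y - k + 1 by lra.
have [yl|yl] := ltP (y - k + 1) l; first by rewrite bumpE ?clamp_mono_in ?yp ?ltW.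
by rewrite clamp_mono_ge// ?ltW// /bump ltNge yl.
Qed.

Lemma clamp_mono_cont (T : topologicalType) (f g : T -> R) (z : T) :
  {for z, continuous f} -> {for z, continuous g} ->
  {for z, continuous (fun z => clamp_mono (f z) (g z))}.
Proof.
move=> cf cg.
have cm : {for z, continuous (fun z => Num.max 0 (Num.min (f z) (g z)))}.
  apply: (@continuous_max R T (cst 0) (fun z => Num.min (f z) (g z))); first exact: cvg_cst.
  exact: (@continuous_min R T f g).
have cX (h : T -> R) (k : nat) : {for z, continuous h} -> {for z, continuous (fun z => h z ^+ k)}.
  by move=> ch; apply: (@continuous_comp _ _ _ h (fun x : R => x ^+ k)); [|exact: exprn_continuous].
apply: (@continuousM _ _ (fun z => Num.max 0 (Num.min (f z) (g z)) ^+ a)); first exact: cX.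
by apply: cX; apply: continuousB.
Qed.

End Bump.

Section PowerRule.
Context {R : realType} {V : normedModType R}.
Implicit Types (W : set V) (f : V -> R).

Lemma has_derivX W v f z l k : has_deriv W v f z l ->
  has_deriv W v (fun y => f y ^+ k) z (k%:R * f z ^+ k.-1 * l).
Proof.
move=> df; elim: k => [|k IH].
  by rewrite !mul0r; exact: has_deriv_cst.
have := has_derivM df IH.
have -> : (fun y => f y * f y ^+ k) = (fun y => f y ^+ k.+1) by apply/funext => y; rewrite exprS.
congr has_deriv; case: k {IH} => [|k] /=; first by rewrite expr0; ring.
by rewrite exprS -[k.+2%:R]natr1; ring.
Qed.

Lemma smoothX W f k : fat W -> smooth_on W f -> smooth_on W (fun y => f y ^+ k).
Proof.
move=> fW sf; elim: k => [|k IH].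
  exact: (@eq_smooth_on _ _ _ (cst 1) _ _ (smooth_cst 1 fW)).
by apply: (@eq_smooth_on _ _ _ (fun y => f y * f y ^+ k)); [move=> y _; rewrite exprS|exact: smoothM].
Qed.

End PowerRule.

Section MonomialFields.
Context {R : realType} {m : nat}.
Local Notation n := m.+1.
Local Notation V := (R^o * 'rV[R]_n)%type.
Variable i : 'I_n.
Local Notation W := (@cut_component R n i).
Implicit Types (q : 'rV[R]_n) (a b : nat) (z : V).

(** [y^a (l - y)^b d/dx] on the i-th arc, zero on the others; here [y] is the
    distance to the initial point of the arc and [l] its length. *)
Definition mono_field a b : family R n := fun c p =>
  bump a b (frac (repr c - lift p 0 i)) (arc_length (lift p) i).

Lemma mono_pullback a b (x : R) q : lift_domain q ->
  pullback (mono_field a b) ((x, q) : V) = bump a b (frac (x - q 0 i)) (arc_length q i).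
Proof.
move=> Uq; rewrite /pullback /mono_field /=.
have [k kZ ->] := repr_to_circle x; have [k' k'Z ->] := lift_to_conf Uq.
have -> : arc_length (q + const_mx k') i = arc_length q i.
  by rewrite /arc_length arc_end_shift !mxE; ring.
congr bump; rewrite !mxE (_ : _ - _ = (x - q 0 i) + (k - k')); last by ring.
by rewrite fracD// rpredB.
Qed.

Lemma arc_length_le1 q : lift_domain q -> arc_length q i <= 1.
Proof. by move=> Uq; rewrite /arc_length lerBlDl; exact: arc_end_bound. Qed.

(** The distances to the two ends of the arc, and their monomials. *)
Definition dist_start z : R := z.1 - z.2 0 i.
Definition dist_end z : R := length_fun i z - dist_start z.
Definition mono a b z : R := dist_start z ^+ a * dist_end z ^+ b.

Lemma smooth_dist_start j : smooth_on (@cut_component R n j) dist_start.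
Proof.
apply: smooth_linear; first exact: fat_cut_component.
- have c1 : continuous (fun z : V => z.1) by move=> z; exact: cvg_fst.
  have c2 := snd_comp_cont (@coord_cont R m i).
  by move=> z; exact: (cvgB (@c1 z) (@c2 z)).
- by move=> c y z; rewrite /dist_start /= !mxE /GRing.scale /=; ring.
Qed.

Lemma smooth_mono a b : smooth_on W (mono a b).
Proof.
have fW := @fat_cut_component R m i; have ss := smooth_dist_start i.
apply: smoothM => //; first exact: smoothX.
apply: smoothX => //; exact: smoothB (smooth_length i) ss.
Qed.

Lemma mono_on_arc a b z : (0 < a)%N -> (0 < b)%N -> W z ->
  pullback (mono_field a b) z = mono a b z.
Proof.
case: z => x q a0 b0 [Uq /= /andP[x1 x2]]; rewrite mono_pullback//.
rewrite bump_frac_arc//; first exact: arc_length_le1.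
by rewrite subr_ge0 x1 /arc_length lerD2r.
Qed.

(** An arc after the i-th one is at distances between [l] and [1] from [p_i]; an
    arc before it is at such distances once translated by a period. *)
Lemma mono_off_arc a b j z : (0 < a)%N -> (0 < b)%N -> j != i -> cut_component j z ->
  pullback (mono_field a b) z = 0.
Proof.
case: z => x q a0 b0 ji [Uq /= /andP[x1 x2]]; rewrite mono_pullback//.
have l0 := arc_length_gt0 i Uq.
have bi := break_bounds i Uq; have bj := break_bounds j Uq.
have ej : arc_end q j <= q 0 ord0 + 1.
  by rewrite -break_pointS -break_point_n; apply: break_point_le; rewrite ?ltn_ord ?leqnn.
have ei : arc_end q i <= q 0 ord0 + 1.
  by rewrite -break_pointS -break_point_n; apply: break_point_le; rewrite ?ltn_ord ?leqnn.
have [lt|lt] : (i < j)%N \/ (j < i)%N.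
  by apply/orP; rewrite -neq_ltn eq_sym.
- have e : arc_end q i <= q 0 j.
    by rewrite -break_pointS -(break_point_ord q j); apply: break_point_le; rewrite // lt ltnW.
  apply: (@bump_frac_out _ a b a0 _ _ 0) => //.
  by rewrite /arc_length; move: bi bj => /andP[? ?] /andP[? ?]; lra.
- have e : arc_end q j <= q 0 i.
    by rewrite -break_pointS -(break_point_ord q i); apply: break_point_le; rewrite // lt ltnW.
  apply: (@bump_frac_out _ a b a0 _ _ (-1)) => //; first by rewrite rpredN rpred1.
  by rewrite /arc_length; move: bi bj => /andP[? ?] /andP[? ?]; lra.
Qed.

Lemma mono_field_smooth a b : (0 < a)%N -> (0 < b)%N -> smooth_section (mono_field a b).
Proof.
move=> a0 b0; split.
  apply/subspace_continuousP => z0 /= Uz0.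
  (* Near [z0] the distance stays within one of its integer part [k] at [z0]. *)
  pose k : R := (Num.floor (dist_start z0))%:~R.
  have kZ : k \is a Num.int by apply/intrP; exists (Num.floor (dist_start z0)).
  pose y z := dist_start z - k.
  pose l z := arc_length z.2 i.
  pose G z := clamp_mono a b (y z) (l z) + clamp_mono a b (y z + 1) (l z).
  have cy : continuous y.
    have c1 : continuous (fun z : V => z.1) by move=> z; exact: cvg_fst.
    have c2 := snd_comp_cont (@coord_cont R m i).
    by move=> z; exact: (cvgB (cvgB (@c1 z) (@c2 z)) (cvg_cst _)).
  have cl : continuous l := snd_comp_cont (@arc_length_cont R m i).
  have cG : {for z0, continuous G}.
    have cy1 : {for z0, continuous (fun z => y z + 1)}.
      exact: (cvgD (@cy z0) (cvg_cst _)).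
    have c1 := @clamp_mono_cont _ a b _ _ _ z0 (@cy z0) (@cl z0).
    have c2 := @clamp_mono_cont _ a b _ _ _ z0 cy1 (@cl z0).
    exact: (cvgD c1 c2).
  have PG z : lift_domain z.2 -> -1 < y z < 1 -> pullback (mono_field a b) z = G z.
    case: z => x q /= Uq yz; rewrite mono_pullback//.
    by rewrite (@bump_frac_clamp _ a b a0 b0 _ _ k)// arc_length_gt0// arc_length_le1.
  have y0 : -1 < y z0 < 1.
    by have := frac_bounds (dist_start z0); rewrite /frac -/k -/(y z0); lra.
  rewrite /from_subspace (PG z0)//.
  apply: (@cvg_trans _ (G z @[z --> within [set z : V | lift_domain z.2] (nbhs z0)])); last first.
    by apply: cvg_within_filter; exact: cG.
  have ny : \forall z \near nbhs z0, -1 < y z < 1.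
    have oI : open (y @^-1` [set` `]-1, 1[]).
      by apply: open_comp => [z _|]; [exact: cy|exact: interval_open].
    have yI : (y @^-1` [set` `]-1, 1[]) z0 by rewrite /= in_itv.
    apply: (@filterS _ (nbhs z0) _ _ _ _ (open_nbhs_nbhs (conj oI yI))).
    by move=> z /=; rewrite in_itv.
  apply: near_eq_cvg; rewrite near_withinE.
  by apply: (@filterS _ (nbhs z0) _ _ _ _ ny) => z yz /= Uz; rewrite PG.
move=> j; have [->|ji] := eqVneq j i.
  apply: (@eq_smooth_on _ _ _ (mono a b)); last exact: smooth_mono.
  by move=> z /set_mem Wz; rewrite mono_on_arc.
apply: (@eq_smooth_on _ _ _ (cst 0)); last by apply: smooth_cst; exact: fat_cut_component.
by move=> z /set_mem Wz; rewrite (mono_off_arc _ _ ji).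
Qed.

(** A smooth section takes values in the fibers. *)
Lemma smooth_section_BVect (u : family R n) p : smooth_section u -> B p -> BVect p (u^~ p).
Proof.
move=> [cu su] Bp; have [Uq qp] := liftP Bp.
have E : (u^~ p) \o @to_circle R = (fun x : R => pullback u ((x, lift p) : V)).
  by apply/funext => x; rewrite pullback_lift.
split.
  rewrite E => x.
  have cx : {for x, continuous (fun x : R => (x, lift p) : V)}.
    by exact: (cvg_pair cvg_id (cvg_cst _)).
  have cw := @cvg_within_comp R V setT [set z : V | lift_domain z.2] _ x cx (fun y _ => Uq).
  rewrite withinET in cw.
  move/subspace_continuousP: cu => /(_ ((x, lift p) : V) Uq) cu.
  exact: (cvg_comp _ _ cw cu).
move=> j; rewrite E.
have H := @fiber_smooth R m j (lift p) Uq (pullback u) (su j); exact: H.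
Qed.

Lemma mono_field_break a b p j : (0 < a)%N -> (0 < b)%N -> B p -> mono_field a b (p j) p = 0.
Proof.
move=> a0 b0 Bp; have [Uq qp] := liftP Bp.
rewrite -(pullback_break Bp) mono_pullback//.
have [->|ji] := eqVneq j i.
  by rewrite subrr (@frac_def _ 0 0) ?subr0 ?lexx ?ltr01// bump0.
have := @mono_off_arc a b j ((lift p 0 j : R, lift p) : V) a0 b0 ji.
rewrite mono_pullback//; apply; split => //=.
by rewrite lexx ltW//; exact: Uq.
Qed.

Lemma mono_field_anchor a b p : (0 < a)%N -> (0 < b)%N -> B p -> anchor (mono_field a b) p = 0.
Proof. by move=> a0 b0 Bp; apply/rowP => j; rewrite !mxE mono_field_break. Qed.

(** The first and second derivatives of [mono] along the arc. *)
Definition dmono a b z : R := a%:R * mono a.-1 b z - b%:R * mono a b.-1 z.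

Lemma has_deriv_mono a b z (U : set V) : has_deriv U ((1, 0) : V) (mono a b) z (dmono a b z).
Proof.
have ds : has_deriv U ((1, 0) : V) dist_start z 1.
  rewrite /has_deriv; apply: (@cvg_trans _ (cst (1 : R) @ within_step U ((1, 0) : V) z)); last exact: cvg_cst.
  apply: near_eq_cvg; near=> h.
  have h0 : h != 0 by near: h; exact: within_step_neq0.
  by rewrite /diff_quot /dist_start /= scaler0 addr0 /GRing.scale /=; field.
have dl : has_deriv U ((1, 0) : V) (length_fun i) z 0.
  by have := @has_deriv_length R m U i ((1, 0) : V) z; rewrite /= !mxE subrr.
have de : has_deriv U ((1, 0) : V) dist_end z (-1).
  have := has_derivD dl (has_derivM (has_deriv_cst U ((1, 0) : V) (-1) z) ds).
  have -> : (fun y : V => length_fun i y + cst (-1) y * dist_start y) = dist_end.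
    by apply/funext => y; rewrite /dist_end /= mulN1r.
  by congr has_deriv; rewrite /=; ring.
have := has_derivM (has_derivX (k := a) ds) (has_derivX (k := b) de).
by congr has_deriv; rewrite /dmono /mono; ring.
Unshelve. all: by end_near. Qed.

Lemma d_x_mono a b z : W z -> d_x i (mono a b) z = dmono a b z.
Proof.
move=> Wz; rewrite d_x.unlock; apply: derive_onE => //; first exact: fat_cut_component.
exact: has_deriv_mono.
Qed.

Definition ddmono a b z : R := a%:R * dmono a.-1 b z - b%:R * dmono a b.-1 z.

Lemma d_xx_mono a b z : open_cell i z -> d_x i (d_x i (mono a b)) z = ddmono a b z.
Proof.
move=> Oz; have Wz := cell_W Oz.
rewrite (@eq_d_x _ _ _ _ (dmono a b))//; last by move=> y Oy; rewrite d_x_mono//; exact: cell_W.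
rewrite d_x.unlock; apply: derive_onE => //; first exact: fat_cut_component.
have D c a' b' := has_derivM (has_deriv_cst W ((1, 0) : V) c z) (@has_deriv_mono a' b' z W).
have := has_derivD (D a%:R a.-1 b) (D (- b%:R) a b.-1).
have -> : (fun y => cst a%:R y * mono a.-1 b y + cst (- b%:R) y * mono a b.-1 y) = dmono a b.
  by apply/funext => y; rewrite /dmono /= mulNr.
by congr has_deriv; rewrite /ddmono /=; ring.
Qed.

(** Before the end of the arc, small positive steps stay in the cut component. *)
Lemma right_derive_on (f : V -> R) (x : R) q : smooth_on W f -> lift_domain q ->
  q 0 i <= x < arc_end q i ->
  right_derive ((1, 0) : V) f ((x, q) : V) = d_x i f (x, q).
Proof.
move=> sf Uq /andP[x1 x2]; have Wz : W ((x, q) : V) by split => //=; rewrite x1 ltW.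
have H := smooth_has_deriv (v := ((1, 0) : V)) sf Wz; rewrite d_x.unlock.
apply: cvg_lim => //; apply: cvg_trans H; apply: cvg_app => P PW.
change (within_step W ((1, 0) : V) ((x, q) : V) P) in PW.
change (\forall h \near (0 : R)^'+, P h).
have d0 : 0 < arc_end q i - x by rewrite subr_gt0.
near=> h.
have h0 : 0 < h by near: h; exact: nbhs_right_gt.
have hd : h < arc_end q i - x by near: h; exact: nbhs_right_lt.
have HP : h != 0 -> W (((x, q) : V) + h *: ((1, 0) : V)) -> P h.
  by near: h; exact: (@cvg_within R (nbhs (0 : R)) _ _ _ PW).
apply: HP; first by rewrite gt_eqF.
rewrite /cut_component /= scaler0 addr0; split => //.
by rewrite [h *: 1]mulr1; lra.
Unshelve. all: by end_near. Qed.

(** The half-open convention in [bump] makes the right derivative at the end of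
    the arc vanish. *)
Lemma dx_mono_field a b (c : circle R) p : (0 < a)%N -> (0 < b)%N -> B p ->
  dx (mono_field a b) c p =
  let y := frac (repr c - lift p 0 i) in let l := arc_length (lift p) i in
  if y < l then a%:R * (y ^+ a.-1 * (l - y) ^+ b) - b%:R * (y ^+ a * (l - y) ^+ b.-1) else 0.
Proof.
move=> a0 b0 Bp; have [Uq qp] := liftP Bp; set q := lift p in Uq qp *.
set y := frac _; set l := arc_length q i => /=.
have /andP[y0 y1] := frac_bounds (repr c - q 0 i); rewrite -/y in y0 y1.
have kZ : ((Num.floor (repr c - q 0 i))%:~R : R) \is a Num.int by apply/intrP; exists (Num.floor (repr c - q 0 i)).
have E : repr c = (q 0 i + y) + (Num.floor (repr c - q 0 i))%:~R by rewrite /y /frac; ring.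
rewrite /dx /right_derive E diff_quot_shift_x//.
have [yl|yl] := ltP y l.
  have yI : q 0 i <= q 0 i + y < arc_end q i.
    by move: yl; rewrite /l /arc_length => yl; lra.
  have := @right_derive_on (pullback (mono_field a b)) _ q ((mono_field_smooth a0 b0).2 i) Uq yI.
  rewrite /right_derive => ->.
  have Wz : W ((q 0 i + y, q) : V) by split => //=; case/andP: yI => -> /ltW ->.
  rewrite d_x.unlock (@eq_derive_on _ _ W setT _ _ (mono a b))//; first last.
  - by move=> z Wz' _; exact: mono_on_arc.
  - exact: openT.
  have := d_x_mono a b Wz; rewrite d_x.unlock => ->.
  rewrite /dmono /mono /dist_end /dist_start /length_fun /= -/l.
  by rewrite (_ : q 0 i + y - q 0 i = y); last ring.
apply: cvg_lim => //.
apply: (@cvg_trans _ (cst (0 : R) @ (0 : R)^'+)); last exact: cvg_cst.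
have d0 : 0 < 1 - y by rewrite subr_gt0.
apply: near_eq_cvg; near=> h.
have h0 : 0 < h by near: h; exact: nbhs_right_gt.
have hd : h < 1 - y by near: h; exact: nbhs_right_lt.
rewrite /diff_quot.
have -> : ((q 0 i + y, q) : V) + h *: ((1, 0) : V) = (q 0 i + y + h, q).
  by congr pair; rewrite /= ?scaler0 ?addr0// [h *: 1]mulr1.
have val s : 0 <= s -> s < 1 -> l <= s -> pullback (mono_field a b) ((q 0 i + s, q) : V) = 0.
  move=> s0 s1 ls; rewrite mono_pullback// (_ : q 0 i + s - q 0 i = s); last ring.
  by rewrite (@frac_def _ s 0) ?subr0 ?s0// /bump ltNge ls.
rewrite -addrA !val//; try lra.
by rewrite subrr mulr0.
Unshelve. all: by end_near. Qed.

Lemma bracket_mono a b a' b' (c : circle R) p :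
  (0 < a)%N -> (0 < b)%N -> (0 < a')%N -> (0 < b')%N -> B p ->
  bracket (mono_field a b) (mono_field a' b') c p =
  mono_field a b c p * dx (mono_field a' b') c p - mono_field a' b' c p * dx (mono_field a b) c p.
Proof.
move=> a0 b0 a0' b0' Bp; rewrite /bracket big1 ?addr0// => j _.
by rewrite !mono_field_break// !mul0r subrr.
Qed.

Lemma bracket_mono_23 (c : circle R) p : B p ->
  bracket (mono_field 2%N 1%N) (mono_field 3%N 1%N) c p = mono_field 4%N 2%N c p.
Proof.
move=> Bp; rewrite bracket_mono// !dx_mono_field//= /mono_field /bump.
move: (frac _) (arc_length _ _) => y l; case: ifP => _; last by rewrite !mul0r subrr.
by ring.
Qed.

Lemma bracket_mono_14 (c : circle R) p : B p ->
  bracket (mono_field 1%N 1%N) (mono_field 4%N 1%N) c p = 3 * mono_field 4%N 2%N c p.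
Proof.
move=> Bp; rewrite bracket_mono// !dx_mono_field//= /mono_field /bump.
move: (frac _) (arc_length _ _) => y l; case: ifP => _; last by rewrite !mul0r subrr mulr0.
by ring.
Qed.

(** [P] is the integrand of [Omega i] at the time [t] of the arc, and [Q] a
    primitive of [l * P]. *)
Lemma Omega_mono a b a' b' p (P Q : R -> R) : (0 < a)%N -> (0 < b)%N -> (0 < a')%N -> (0 < b')%N ->
  B p -> let l := arc_length (lift p) i in
  (forall t : R, dmono a b ((lift p 0 i + t * l, lift p) : V) * ddmono a' b' ((lift p 0 i + t * l, lift p) : V) -
     ddmono a b ((lift p 0 i + t * l, lift p) : V) * dmono a' b' ((lift p 0 i + t * l, lift p) : V) = P t) ->
  (forall t : R, is_derive t 1 Q (l * P t)) ->
  Omega i p ((mono_field a b)^~ p) ((mono_field a' b')^~ p) = Q 1 - Q 0.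
Proof.
move=> a0 b0 a0' b0' Bp l PE dQ; have [Uq qp] := liftP Bp.
have cell (c d : nat) x : (0 < c)%N -> (0 < d)%N -> lift p 0 i < x < arc_end (lift p) i ->
    mono_field c d (to_circle x) p = mono c d ((x, lift p) : V).
  move=> c0 d0 /andP[x1 x2]; rewrite -(pullback_lift _ _ Bp) mono_on_arc//.
  by split => //=; rewrite !ltW.
rewrite /Omega (Omega_arc Uq (smooth_mono a b) (smooth_mono a' b')); first last.
- by move=> x xI /=; exact: cell.
- by move=> x xI /=; exact: cell.
have sd := smooth_density (smooth_mono a b) (smooth_mono a' b').
have cI := arc_integrand_continuous sd Uq.
rewrite /arc_integral /par_integral; apply: (@integral_FTC _ 0 1 _ Q).
- exact: ltr01.
- exact: cI.
- apply: continuous_subspaceT => t; apply: differentiable_continuous.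
  by apply/derivable1_diffP; have [] := dQ t.
- move=> t t01; have Oz := arc_point_cell i Uq t01; have Wz := cell_W Oz.
  have := dQ t; congr is_derive.
  rewrite /par_integrand expr0 mul1r /gf_density d_x_mono// d_x_mono// d_xx_mono// d_xx_mono//.
  by rewrite arc_point PE.
Qed.

Lemma Omega_mono_14 p : B p ->
  Omega i p ((mono_field 1%N 1%N)^~ p) ((mono_field 4%N 1%N)^~ p) = arc_length (lift p) i ^+ 5.
Proof.
move=> Bp; set l := arc_length (lift p) i.
pose P (t : R) := l ^+ 4 * (12 * t ^+ 2 - 36 * t ^+ 3 + 30 * t ^+ 4).
pose Q (t : R) := l ^+ 5 * (4 * t ^+ 3 - 9 * t ^+ 4 + 6 * t ^+ 5).
transitivity (Q 1 - Q 0); last by rewrite /Q; ring.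
apply: (@Omega_mono 1%N 1%N 4%N 1%N p P) => //.
- move=> t; rewrite /P /ddmono /dmono /mono /dist_end /dist_start /length_fun /= -/l.
  by rewrite (_ : _ + t * l - _ = t * l); [ring|ring].
- by move=> t; rewrite /Q /P -/l; apply: is_derive_eq; rewrite /GRing.scale /=; ring.
Qed.

Lemma Omega_mono_23 p : B p ->
  Omega i p ((mono_field 2%N 1%N)^~ p) ((mono_field 3%N 1%N)^~ p) = 2 / 5 * arc_length (lift p) i ^+ 5.
Proof.
move=> Bp; set l := arc_length (lift p) i.
pose P (t : R) := l ^+ 4 * (6 * t ^+ 2 - 16 * t ^+ 3 + 12 * t ^+ 4).
pose Q (t : R) := l ^+ 5 * (2 * t ^+ 3 - 4 * t ^+ 4 + 12 / 5 * t ^+ 5).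
transitivity (Q 1 - Q 0); last by rewrite /Q; field.
apply: (@Omega_mono 2%N 1%N 3%N 1%N p P) => //.
- move=> t; rewrite /P /ddmono /dmono /mono /dist_end /dist_start /length_fun /= -/l.
  by rewrite (_ : _ + t * l - _ = t * l); [ring|ring].
- by move=> t; rewrite /Q /P -/l; apply: is_derive_eq; rewrite /GRing.scale /=; field.
Qed.

(** Equally spaced points. *)
Lemma B_neq0 : exists p : conf R n, B p.
Proof.
pose q : 'rV[R]_n := \row_j (j%:R / n%:R).
exists (to_conf q); exists q => // j.
rewrite -break_pointS /break_point.
have n0 : 0 < n%:R :> R by rewrite ltr0n.
case: ltnP => jn; rewrite !mxE.
  by rewrite inordK// ltr_pM2r ?invr_gt0// ltr_nat.
by rewrite mul0r add0r ltr_pdivrMr// mul1r ltr_nat.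
Qed.

(** A coboundary vanishes on [3 u_2 /\ u_3 - u_1 /\ u_4], where [u_a] is the field
    [mono_field a 1]: the anchors are zero and so is [3 [u_2, u_3] - [u_1, u_4]].
    On this element [Omega i] takes the value [l ^+ 5 / 5]. *)
Lemma Omega_not_coboundary : ~ is_coboundary (@Omega R n i).
Proof.
move=> [Th [linT _] dT]; have [p Bp] := B_neq0.
have s := mono_field_smooth.
have bv := smooth_section_BVect (s 4%N 2%N isT isT) Bp.
have key a a' : (0 < a)%N -> (0 < a')%N ->
    Omega i p ((mono_field a 1%N)^~ p) ((mono_field a' 1%N)^~ p) =
    - Th p ((bracket (mono_field a 1%N) (mono_field a' 1%N))^~ p).
  move=> a0 a0'; rewrite (dT _ _ (s a 1%N a0 isT) (s a' 1%N a0' isT) _ Bp).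
  by rewrite /Lie_derive !mono_field_anchor// !derive0 subrr sub0r.
have K23 := key 2%N 3%N isT isT; have K14 := key 1%N 4%N isT isT.
rewrite Omega_mono_23// in K23; rewrite Omega_mono_14// in K14.
have E23 : (bracket (mono_field 2%N 1%N) (mono_field 3%N 1%N))^~ p = (mono_field 4%N 2%N)^~ p.
  by apply/funext => c; rewrite bracket_mono_23.
have E14 : (bracket (mono_field 1%N 1%N) (mono_field 4%N 1%N))^~ p =
    (fun c => 2 * mono_field 4%N 2%N c p + mono_field 4%N 2%N c p).
  by apply/funext => c; rewrite bracket_mono_14//; ring.
rewrite E23 in K23; rewrite E14 (linT p Bp 2 _ _ bv bv) in K14.
have l5 : 0 < arc_length (lift p) i ^+ 5 by rewrite exprn_gt0//; exact: (arc_length_gt0 i (liftP Bp).1).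
move: (arc_length (lift p) i ^+ 5) (Th p ((mono_field 4%N 2%N)^~ p)) K23 K14 l5 => x y H1 H2 H3.
by clear -H1 H2 H3; lra.
Qed.

End MonomialFields.

Theorem theorem1p1 (R : realType) (n : nat) (hn : (1 <= n)%N) (i : 'I_n) :
  is_form2 (@Omega R n i) /\
  is_cocycle (@Omega R n i) /\
  ~ is_coboundary (@Omega R n i).
Proof.
case: n hn i => // m _ i; split; first exact: Omega_form2.
by split; [exact: Omega_cocycle|exact: Omega_not_coboundary].
Qed.
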